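(* Assume: (Smoothness) for each $i\in\{1,\dots,n\}$, $f_i$ is differentiable in $u$ and in $v_i$, $\nabla_u f_i(u,v_i)$ is $L_u$-Lipschitz in $u$ and $L_{uv}$-Lipschitz in $v_i$, $\nabla_v f_i(u,v_i)$ is $L_v$-Lipschitz in $v_i$ and $L_{vu}$-Lipschitz in $u$; put $L=\max\{L_u,L_v,L_{uv},L_{vu}\}$. (Stochastic gradients) for each $i$ and all $u,v_i$, $\mathbb{E}[\nabla_u F(u,v_i;\xi_i)]=\nabla_u f_i(u,v_i)$, $\mathbb{E}[\nabla_v F(u,v_i;\xi_i)]=\nabla_v f_i(u,v_i)$, $\mathbb{E}\|\nabla_u F(u,v_i;\xi_i)-\nabla_u f_i(u,v_i)\|^2\le\sigma_u^2$ and $\mathbb{E}\|\nabla_v F(u,v_i;\xi_i)-\nabla_v f_i(u,v_i)\|^2\le\sigma_v^2$. (Bounded gradient dissimilarity) there is $b>0$ such that $\frac1n\sum_{i=1}^n\|\nabla_u f_i(u,v_i)\|^2\le b^2+\|\nabla_u f(u,\mathbf v)\|^2$ for all $u,\mathbf v$. Run FedAvg-P for $T$ rounds with $$\gamma=\Big(32LK+\sqrt{\tfrac{3LKT}{F_0}\big(\tfrac{4(n-m)Kb^2}{mn}+\tfrac{\sigma_u^2}{m}+\tfrac{m\sigma_v^2}{n}\big)}\Big)^{-1},\quad \eta_v\ge\sqrt{\tfrac nm},\quad \eta_u\ge\max\Big(\sqrt m,\sqrt{\tfrac{b^2T}{LF_0}}\Big),$$ where $\gamma=\gamma_u\eta_u=\gamma_v\eta_v$.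 Then $$\frac1T\sum_{t=0}^{T-1}\big(\mathcal G_u^t+\hat{\mathcal G}_{\mathbf v}^t\big)\le 8\sqrt{3\Big(\frac{4(n-m)Kb^2}{mn}+\frac{\sigma_u^2}{m}+\frac{m\sigma_v^2}{n}\Big)\frac{LF_0}{KT}}+\frac{129LF_0}{T}.$$
   Context: Problem: $n$ clients, shared variable $u\in\mathbb R^{d_u}$, personal variables $\mathbf v=[v_1;\dots;v_n]$, $v_i\in\mathbb R^{d_v}$; $f_i(u,v_i)=\mathbb E_{\xi_i\sim\mathcal D_i}[F(u,v_i;\xi_i)]$ and $f(u,\mathbf v)=\frac1n\sum_{i=1}^n f_i(u,v_i)$. $\nabla_u,\nabla_v$ are the partial gradients in the first and second argument; $\|\cdot\|$ is Euclidean. FedAvg-P algorithm: parameters $T\ge1$ rounds, $K\ge1$ local steps, $1\le m\le n$, step sizes $\gamma_u,\gamma_v,\eta_u,\eta_v>0$ satisfying $\gamma_u\eta_u=\gamma_v\eta_v=:\gamma$; deterministic initial point $(u^0,\mathbf v^0)$. In each round $t=0,\dots,T-1$: draw $\mathcal S^t\subset\{1,\dots,n\}$ uniformly at random among subsets of size $m$. Each $i\in\mathcal S^t$ sets $u_{i,0}^t=u^t$, $v_{i,0}^t=v_i^t$, and for $k=0,\dots,K-1$ performs $u_{i,k+1}^t=u_{i,k}^t-\gamma_u\nabla_uF(u_{i,k}^t,v_{i,k}^t;\xi_{i,k}^t)$, $v_{i,k+1}^t=v_{i,k}^t-\gamma_v\nabla_vF(u_{i,k}^t,v_{i,k}^t;\xi_{i,k}^t)$,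 with $\xi_{i,k}^t\sim\mathcal D_i$; then $v_i^{t+1}=(1-\eta_v)v_i^t+\eta_v v_{i,K}^t$. For $i\notin\mathcal S^t$, $v_i^{t+1}=v_i^t$. Finally $u^{t+1}=(1-\eta_u)u^t+\frac{\eta_u}{m}\sum_{i\in\mathcal S^t}u_{i,K}^t$. All samples $\xi_{i,k}^t$ and all sets $\mathcal S^t$ are mutually independent. Notation: $\mathcal G_u^t=\mathbb E\|\nabla_uf(u^t,\mathbf v^t)\|^2$, $\hat{\mathcal G}_{\mathbf v}^t=\frac{m}{n^2}\sum_{i=1}^n\mathbb E\|\nabla_vf_i(u^t,v_i^t)\|^2$, $F_0=f(u^0,\mathbf v^0)-\inf_{u,\mathbf v}f(u,\mathbf v)$. Assume $L>0$ and $0<F_0<\infty$. *)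

(* Defs.v *)
From mathcomp Require Import all_boot all_order all_algebra.
From mathcomp Require Import all_classical all_reals all_analysis.

Set Implicit Arguments.
Unset Strict Implicit.
Unset Printing Implicit Defensive.

Import Order.TTheory GRing.Theory Num.Theory.
Import numFieldNormedType.Exports.

Local Open Scope classical_set_scope.
Local Open Scope ring_scope.

(* The norm [`|x|] that the library puts on ['rV[R]_d] is the sup norm, so the
   Euclidean norm is defined here. *)
Definition enorm (R : realType) (d : nat) (x : 'rV[R]_d) : R :=
  Num.sqrt (\sum_(j < d) x ord0 j ^+ 2).

Definition gradient (R : realType) (d : nat) (g : 'rV[R]_d -> R)
    (x : 'rV[R]_d) : 'rV[R]_d :=
  \row_(j < d) 'D_(delta_mx ord0 j) g x.

(* The second argument of [nabla_u] has an arbitrary type because it is either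
   one personal variable or the family of all of them. *)
Definition nabla_u (R : realType) (du : nat) (V : Type)
    (g : 'rV[R]_du -> V -> R) (u : 'rV[R]_du) (v : V) : 'rV[R]_du :=
  gradient (g^~ v) u.

Definition nabla_v (R : realType) (dv : nat) (U : Type)
    (g : U -> 'rV[R]_dv -> R) (u : U) (v : 'rV[R]_dv) : 'rV[R]_dv :=
  gradient (g u) v.

Definition elipschitz (R : realType) (d1 d2 : nat) (L : R)
    (g : 'rV[R]_d1 -> 'rV[R]_d2) : Prop :=
  forall x y, enorm (g x - g y) <= L * enorm (x - y).

(* [G] is a random vector with expectation [mu]. Integrability is part of the
   definition: the integral of a non-integrable function has a junk value. *)
Definition has_mean (R : realType) (dX : measure_display)
    (X : measurableType dX) (D : probability X R) (d : nat)
    (G : X -> 'rV[R]_d) (mu : 'rV[R]_d) : Prop :=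
  forall j : 'I_d,
    D.-integrable setT (fun x => (G x ord0 j)%:E) /\
    'E_D[fun x => G x ord0 j]%E = (mu ord0 j)%:E.

Definition mutually_independent (R : realType) (dOmega : measure_display)
    (Omega : measurableType dOmega) (P : probability Omega R) (I : finType)
    (G : I -> set (set Omega)) : Prop :=
  forall (J : {set I}) (E : I -> set Omega),
    (forall i, i \in J -> G i (E i)) ->
    P (\bigcap_(i in [set` J]) E i) = (\prod_(i in J) P (E i))%E.

Section problem.
Variables (R : realType) (n du dv : nat).
Variables (dX : measure_display) (X : measurableType dX).
Variables (D : 'I_n -> probability X R).
Variable F : 'rV[R]_du -> 'rV[R]_dv -> X -> R.

Definition client_loss (i : 'I_n) (u : 'rV[R]_du) (v : 'rV[R]_dv) : R :=
  \int[D i]_x F u v x.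

Definition global_loss (u : 'rV[R]_du) (v : 'I_n -> 'rV[R]_dv) : R :=
  n%:R^-1 * \sum_(i < n) client_loss i u (v i).

Definition initial_gap (u0 : 'rV[R]_du) (v0 : 'I_n -> 'rV[R]_dv) : \bar R :=
  ((global_loss u0 v0)%:E -
   ereal_inf (range (fun p : 'rV[R]_du * ('I_n -> 'rV[R]_dv) =>
                       (global_loss p.1 p.2)%:E)))%E.

Definition sample_nabla_u (u : 'rV[R]_du) (v : 'rV[R]_dv) (x : X) :=
  nabla_u (fun u' v' => F u' v' x) u v.

Definition sample_nabla_v (u : 'rV[R]_du) (v : 'rV[R]_dv) (x : X) :=
  nabla_v (fun u' v' => F u' v' x) u v.

(* What the expectations and gradients in the problem need in order to make
   sense. *)
Definition well_posed : Prop :=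
  (forall i u v, (D i).-integrable setT (fun x => (F u v x)%:E)) /\
  (forall u v x, differentiable (fun u' => F u' v x) u /\
                 differentiable (fun v' => F u v' x) v).

Definition smooth_losses (Lu Lv Luv Lvu : R) : Prop :=
  forall i : 'I_n,
    [/\ forall u v, differentiable ((client_loss i)^~ v) u /\
                    differentiable (client_loss i u) v,
        forall v, elipschitz Lu (fun u => nabla_u (client_loss i) u v),
        forall u, elipschitz Luv (fun v => nabla_u (client_loss i) u v),
        forall u, elipschitz Lv (fun v => nabla_v (client_loss i) u v) &
        forall v, elipschitz Lvu (fun u => nabla_v (client_loss i) u v)].

Definition stochastic_gradients (sigma_u sigma_v : R) : Prop :=
  forall (i : 'I_n) (u : 'rV[R]_du) (v : 'rV[R]_dv),
    [/\ has_mean (D i) (sample_nabla_u u v) (nabla_u (client_loss i) u v),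
        has_mean (D i) (sample_nabla_v u v) (nabla_v (client_loss i) u v),
        ('E_(D i)[fun x => (enorm (sample_nabla_u u v x -
                                   nabla_u (client_loss i) u v) ^+ 2)%R]
           <= (sigma_u ^+ 2)%:E)%E &
        ('E_(D i)[fun x => (enorm (sample_nabla_v u v x -
                                   nabla_v (client_loss i) u v) ^+ 2)%R]
           <= (sigma_v ^+ 2)%:E)%E].

Definition bounded_dissimilarity (b : R) : Prop :=
  forall (u : 'rV[R]_du) (v : 'I_n -> 'rV[R]_dv),
    n%:R^-1 * \sum_(i < n) enorm (nabla_u (client_loss i) u (v i)) ^+ 2
      <= b ^+ 2 + enorm (nabla_u global_loss u v) ^+ 2.

Section algorithm.
Variables (m K : nat) (gamma_u gamma_v eta_u eta_v : R).

Fixpoint local_steps (u : 'rV[R]_du) (v : 'rV[R]_dv) (xs : nat -> X)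
    (k : nat) : 'rV[R]_du * 'rV[R]_dv :=
  if k is k'.+1 then
    let: (uk, vk) := local_steps u v xs k' in
    (uk - gamma_u *: sample_nabla_u uk vk (xs k'),
     vk - gamma_v *: sample_nabla_v uk vk (xs k'))
  else (u, v).

Definition fedavgp_round (St : {set 'I_n}) (xs : 'I_n -> nat -> X)
    (s : 'rV[R]_du * ('I_n -> 'rV[R]_dv)) :
    'rV[R]_du * ('I_n -> 'rV[R]_dv) :=
  let: (u, v) := s in
  let out i := local_steps u (v i) (xs i) K in
  ((1 - eta_u) *: u + (eta_u / m%:R) *: \sum_(i in St) (out i).1,
   fun i => if i \in St then (1 - eta_v) *: v i + eta_v *: (out i).2 else v i).

Fixpoint fedavgp (u0 : 'rV[R]_du) (v0 : 'I_n -> 'rV[R]_dv)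
    (S : nat -> {set 'I_n}) (xs : 'I_n -> nat -> nat -> X) (t : nat) :
    'rV[R]_du * ('I_n -> 'rV[R]_dv) :=
  if t is t'.+1 then
    fedavgp_round (S t') (fun i => xs i t') (fedavgp u0 v0 S xs t')
  else (u0, v0).

End algorithm.

Section randomness.
Variables (dOmega : measure_display) (Omega : measurableType dOmega).
Variable P : probability Omega R.

Definition uniform_subset (m : nat) (S : Omega -> {set 'I_n}) : Prop :=
  forall A : {set 'I_n},
    measurable [set w | S w = A] /\
    P [set w | S w = A] =
      (if #|A| == m then ('C(n, m)%:R)^-1 else 0 : R)%:E.

(* The events generated by one of the random objects of the run: the sample
   [xi i t k] or the set [S t]. *)
Definition run_events (T K : nat) (xi : 'I_n -> nat -> nat -> {mfun Omega >-> X})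
    (S : nat -> Omega -> {set 'I_n}) (a : 'I_n * 'I_T * 'I_K + 'I_T) :
    set (set Omega) :=
  match a with
  | inl (i, t, k) => [set xi i t k @^-1` B | B in measurable]
  | inr t => [set S t @^-1` B | B in setT]
  end.

Definition fedavgp_sampling (m T K : nat)
    (xi : 'I_n -> nat -> nat -> {mfun Omega >-> X})
    (S : nat -> Omega -> {set 'I_n}) : Prop :=
  [/\ forall (i : 'I_n) (t : 'I_T) (k : 'I_K) B, measurable B ->
        distribution P (xi i t k) B = D i B,
      forall t : 'I_T, uniform_subset m (S t) &
      mutually_independent P (@run_events T K xi S)].

Definition Gu (st : Omega -> 'rV[R]_du * ('I_n -> 'rV[R]_dv)) : \bar R :=
  'E_P[fun w => (enorm (nabla_u global_loss (st w).1 (st w).2) ^+ 2)%R]%E.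

Definition Gv_hat (m : nat) (st : Omega -> 'rV[R]_du * ('I_n -> 'rV[R]_dv)) :
    \bar R :=
  ((m%:R / n%:R ^+ 2)%:E *
   \sum_(i < n)
     'E_P[fun w => (enorm (nabla_v (client_loss i) (st w).1 ((st w).2 i)) ^+ 2)%R])%E.

End randomness.
End problem.

(* Main.v *)
(* Local steps are run for every client, participating or not, so that they are
   independent of the drawn set [S t], and the average over [S t] is an average over all
   subsets of size [m].  A local run is the sum of the true gradients at the local
   iterates and of noises that are pairwise orthogonal, each being centered given
   the samples used before it and those of the other clients.  Since the loss is
   smooth in each block, a round decreases the mean loss by
   [gamma K / 4] times the squared gradients, up to a variance term
   [3 L gamma^2 K A] and a drift term.  The drift of the local iterates from
   the start of the round bounds itself because [gamma L K <= 1 / 32]; the lower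
   bounds on [eta_u] and [eta_v] turn what is left of it into quantities of the
   same order as the other terms.  Summing over the rounds and inserting [gamma]
   gives the rate. *)
Require Import Defs.
From mathcomp Require Import all_boot all_order all_algebra.
From mathcomp Require Import all_classical all_reals all_analysis.
From mathcomp Require Import measurable_realfun ring lra.

Set Implicit Arguments.
Unset Strict Implicit.
Unset Printing Implicit Defensive.

Import Order.TTheory GRing.Theory Num.Theory.
Import numFieldNormedType.Exports.

Local Open Scope classical_set_scope.
Local Open Scope ring_scope.

(** * Euclidean vectors and descent *)

Section dot_product.
Context {R : realType} {d : nat}.
Implicit Types (x y z : 'rV[R]_d) (a c : R).

(** Estimates are kept in squared form through [dot], so [enorm] and its square root appear only at
    the interface with the statement. Conditional expectation is replaced by Fubini: the past is the
    space [Omega] with the sigma-algebra generated by a chosen set of random sources, and the joint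
    law of this past and a fresh sample is a product. Adaptedness is then ordinary measurability on
    a coarser space, so one measurability lemma serves every choice of the past. That measurability
    has to come from little: [F] is known to be measurable in the sample only at fixed parameters,
    and differentiable only in each block separately. Random parameters are therefore inserted one
    block at a time by a Caratheodory argument. Square integrability of all iterates, by induction
    along the run, precedes every estimate. It makes all expectations real numbers, without which
    linearity and the self-bounding of the drift would be meaningless. *)

Definition dot x y : R := \sum_(j < d) x ord0 j * y ord0 j.

Lemma dotC x y : dot x y = dot y x.
Proof. by apply: eq_bigr => j _; rewrite mulrC. Qed.

Lemma dotDl x y z : dot (x + y) z = dot x z + dot y z.
Proof. by rewrite -big_split; apply: eq_bigr => j _; rewrite mxE mulrDl. Qed.

Lemma dotZl a x y : dot (a *: x) y = a * dot x y.
Proof. by rewrite mulr_sumr; apply: eq_bigr => j _; rewrite mxE mulrA. Qed.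

Lemma dotDr x y z : dot x (y + z) = dot x y + dot x z.
Proof. by rewrite dotC dotDl !(dotC _ x). Qed.

Lemma dotZr a x y : dot x (a *: y) = a * dot x y.
Proof. by rewrite dotC dotZl dotC. Qed.

Lemma dotNl x y : dot (- x) y = - dot x y.
Proof. by rewrite -scaleN1r dotZl mulN1r. Qed.

Lemma dotNr x y : dot x (- y) = - dot x y.
Proof. by rewrite dotC dotNl dotC. Qed.

Lemma dotBl x y z : dot (x - y) z = dot x z - dot y z.
Proof. by rewrite dotDl dotNl. Qed.

Lemma dotBr x y z : dot x (y - z) = dot x y - dot x z.
Proof. by rewrite dotDr dotNr. Qed.

Lemma dot0l y : dot 0 y = 0.
Proof. by rewrite -(scale0r 0) dotZl mul0r. Qed.

Lemma dot0r y : dot y 0 = 0.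
Proof. by rewrite dotC dot0l. Qed.

Lemma dot_suml (I : Type) (r : seq I) (Q : pred I) (f : I -> 'rV[R]_d) y :
  dot (\sum_(i <- r | Q i) f i) y = \sum_(i <- r | Q i) dot (f i) y.
Proof.
elim/big_rec2: _ => [|i u v _ <-]; first exact: dot0l.
by rewrite dotDl.
Qed.

Lemma dot_sumr (I : Type) (r : seq I) (Q : pred I) (f : I -> 'rV[R]_d) y :
  dot y (\sum_(i <- r | Q i) f i) = \sum_(i <- r | Q i) dot y (f i).
Proof. by rewrite dotC dot_suml; apply: eq_bigr => i _; rewrite dotC. Qed.

Lemma dot_ge0 x : 0 <= dot x x.
Proof. by apply: sumr_ge0 => j _; rewrite -expr2 sqr_ge0. Qed.

Lemma enorm_sqr x : enorm x ^+ 2 = dot x x.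
Proof.
rewrite /enorm sqr_sqrtr; last by apply: sumr_ge0 => j _; exact: sqr_ge0.
by apply: eq_bigr => j _; rewrite expr2.
Qed.

Lemma dot_sqrD x y : dot (x + y) (x + y) = dot x x + 2 * dot x y + dot y y.
Proof. by rewrite dotDl !dotDr (dotC y x); ring. Qed.

(** Expand [0 <= dot (c *: x - y) (c *: x - y)] and divide by [2 * c]. The weight stays free because
    each use balances it differently. *)
Lemma dot_young c x y : 0 < c ->
  dot x y <= c / 2 * dot x x + (2 * c)^-1 * dot y y.
Proof.
move=> c0; have := dot_ge0 (c *: x - y).
rewrite dotBl !dotBr !dotZl !dotZr (dotC y x) => h.
rewrite -subr_ge0.
have -> : c / 2 * dot x x + (2 * c)^-1 * dot y y - dot x y =
  (2 * c)^-1 * (c * (c * dot x x) - c * dot x y - (c * dot x y - dot y y)).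
  by field; rewrite gt_eqF.
by rewrite mulr_ge0// invr_ge0; lra.
Qed.

Lemma dot_sqrD_le x y : dot (x + y) (x + y) <= 2 * dot x x + 2 * dot y y.
Proof.
have := dot_ge0 (x - y).
rewrite !dot_sqrD dotNr dotNl dotNr => h; lra.
Qed.

(** Expanding the square into all pairs and applying Young with weight 1 to each pair counts every
    diagonal term [#|A|] times. *)
Lemma dot_sqr_sum_le (I : finType) (A : {pred I}) (f : I -> 'rV[R]_d) :
  dot (\sum_(i in A) f i) (\sum_(i in A) f i) <=
    #|A|%:R * \sum_(i in A) dot (f i) (f i).
Proof.
have h x y : dot x y <= 2^-1 * dot x x + 2^-1 * dot y y.
  have := dot_young x y (@ltr01 R); lra.
rewrite dot_suml.
have : \sum_(i in A) dot (f i) (\sum_(j in A) f j) <=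
    \sum_(i in A) (2^-1 * (#|A|%:R * dot (f i) (f i)) +
                   2^-1 * \sum_(j in A) dot (f j) (f j)).
  apply: ler_sum => i _; rewrite dot_sumr.
  apply: (le_trans (ler_sum _ (fun j _ => h (f i) (f j)))).
  by rewrite big_split/= sumr_const -mulr_sumr lerD2r -[_ *+ #|_|]mulr_natl mulrCA lexx.
move=> /le_trans; apply; rewrite big_split/= sumr_const -!mulr_sumr -[_ *+ #|_|]mulr_natl; lra.
Qed.

Lemma dot_sqr_sum_ord_le (k : nat) (f : 'I_k -> 'rV[R]_d) :
  dot (\sum_i f i) (\sum_i f i) <= k%:R * \sum_i dot (f i) (f i).
Proof. by have := dot_sqr_sum_le (mem 'I_k) f; rewrite card_ord. Qed.

End dot_product.

Section descent.
Context {R : realType} {d : nat}.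
Implicit Types (g : 'rV[R]_d -> R) (x h : 'rV[R]_d).

Lemma derive_gradient g x h : differentiable g x ->
  'D_h g x = dot (gradient g x) h.
Proof.
move=> dg; rewrite deriveE// [in LHS](row_sum_delta h) linear_sum/=.
by apply: eq_bigr => j _; rewrite linearZ/= mxE deriveE// mulrC.
Qed.

(** The difference quotient of [g] in direction [h] and that of its restriction to the line are the
    same function of the increment, so derivability and the value transfer together. *)
Lemma is_derive_line g x h (s : R) : differentiable g (x + s *: h) ->
  is_derive s 1 (fun r => g (x + r *: h)) (dot (gradient g (x + s *: h)) h).
Proof.
move=> dg; have := @diff_derivable _ _ _ g _ h dg.
have E : (fun r : R => r^-1 *: ((g \o shift (x + s *: h)) (r *: h) - g (x + s *: h)))
  = (fun r : R => r^-1 *: (((fun r => g (x + r *: h)) \o shift s) (r *: 1) -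
       g (x + s *: h))).
  apply/funext => r /=; congr (_ *: (g _ - _)).
  by rewrite (mulr1 r : r *: (1 : R) = r) scalerDl addrCA.
rewrite /derivable E => dl; split; first exact: dl.
by rewrite -derive_gradient// /derive E.
Qed.

(** No integral along the segment is needed: [phi], the loss on the segment minus its quadratic
    majorant, has a nonpositive derivative, hence [phi 1 <= phi 0]. *)
Lemma descent_quadratic g (L : R) x h : 0 < L ->
  (forall y, differentiable g y) ->
  (forall y z, dot (gradient g y - gradient g z) (gradient g y - gradient g z)
                 <= L ^+ 2 * dot (y - z) (y - z)) ->
  g (x + h) <= g x + dot (gradient g x) h + L / 2 * dot h h.
Proof.
move=> L0 dg lip.
pose phi (s : R) := g (x + s *: h) - (dot (gradient g x) h * s
                      + L / 2 * dot h h * s ^+ 2).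
pose dphi (s : R) := dot (gradient g (x + s *: h)) h - (dot (gradient g x) h
                      + L * dot h h * s).
have dphiP (s : R) : is_derive s (1 : R) phi (dphi s).
  have := is_derive_line (dg (x + s *: h)) => ?.
  by apply: is_derive_eq; rewrite /dphi /GRing.scale/=; field.
have dphi_le0 (s : R) : 0 < s -> dphi s <= 0.
  move=> s0; rewrite /dphi opprD addrA -dotBl subr_le0.
  (* The gradient changes by at most [L s |h|] in norm. With this weight the two halves of Young's
     inequality are equal, each [L s |h|^2 / 2], and add up to the derivative of the majorant. *)
  have Ls0 : 0 < (L * s)^-1 by rewrite invr_gt0 mulr_gt0.
  apply: (le_trans (dot_young _ _ Ls0)).
  have := lip (x + s *: h) x; rewrite addrAC subrr add0r dotZl dotZr => hl.
  have : (L * s)^-1 / 2 * dot (gradient g (x + s *: h) - gradient g x)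
      (gradient g (x + s *: h) - gradient g x) <=
    (L * s)^-1 / 2 * (L ^+ 2 * (s * (s * dot h h))).
    by rewrite ler_pM2l// divr_gt0.
  move=> H; apply: (le_trans (lerD H (lexx _))).
  rewrite le_eqVlt; apply/orP; left; apply/eqP; field.
  by rewrite !gt_eqF.
have : phi 1 <= phi 0.
  apply: (@ler0_derive1_le_cc _ phi 0 1) => //; rewrite ?in_itv/= ?lexx ?ler01//.
  - by move=> s; rewrite in_itv/= => /andP[s0 _]; rewrite derive1E derive_val; exact: dphi_le0.
  - apply: derivable_within_continuous => s _; exact: ex_derive.
rewrite /phi scale1r scale0r addr0 mulr1 mulr0 expr1n expr0n/=; lra.
Qed.
End descent.

(** * Measurability without a measurable structure on vectors *)

Section measurable_vectors.
Context {R : realType} {dY : measure_display} {Y : measurableType dY} {d : nat}.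
Implicit Types (U V : Y -> 'rV[R]_d).

Lemma measurable_fun_rsum (I : Type) (r : seq I) (Q : pred I) (f : I -> Y -> R) :
  (forall i, measurable_fun setT (f i)) ->
  measurable_fun setT (fun y => \sum_(i <- r | Q i) f i y).
Proof.
move=> mf; elim: r => [|i r IH].
  by under eq_fun do rewrite big_nil; exact: measurable_cst.
under eq_fun do rewrite big_cons; case: (Q i) => //; exact: measurable_funD.
Qed.

Definition vmeasurable U := forall j, measurable_fun setT (fun y => U y ord0 j).

Lemma vmeasurable_cst u : vmeasurable (fun=> u).
Proof. by move=> j; exact: measurable_cst. Qed.

Lemma vmeasurableD U V : vmeasurable U -> vmeasurable V ->
  vmeasurable (fun y => U y + V y).
Proof.
move=> mU mV j.
by under eq_fun do rewrite mxE; exact: measurable_funD.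
Qed.

Lemma vmeasurableZ (a : R) U : vmeasurable U -> vmeasurable (fun y => a *: U y).
Proof.
move=> mU j.
by under eq_fun do rewrite mxE; apply: measurable_funM => //; exact: measurable_cst.
Qed.

Lemma vmeasurableB U V : vmeasurable U -> vmeasurable V ->
  vmeasurable (fun y => U y - V y).
Proof.
move=> mU mV; under eq_fun do rewrite -scaleN1r.
exact: vmeasurableD mU (vmeasurableZ _ mV).
Qed.

Lemma vmeasurable_sum (I : Type) (r : seq I) (Q : pred I) (f : I -> Y -> 'rV[R]_d) :
  (forall i, vmeasurable (f i)) -> vmeasurable (fun y => \sum_(i <- r | Q i) f i y).
Proof.
move=> mf; elim: r => [|i r IH].
  by under eq_fun do rewrite big_nil; exact: vmeasurable_cst.
under eq_fun do rewrite big_cons; case: (Q i) => //; exact: vmeasurableD.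
Qed.

Lemma measurable_dot U V : vmeasurable U -> vmeasurable V ->
  measurable_fun setT (fun y => dot (U y) (V y)).
Proof.
by move=> mU mV; apply: measurable_fun_rsum => j; exact: measurable_funM.
Qed.

(* Approximate [U] by the countably valued functions [floor (k U) / k]. *)
Lemma measurable_fun_caratheodory (h : 'rV[R]_d -> Y -> R) U :
  (forall y, continuous (h^~ y)) -> (forall u, measurable_fun setT (h u)) ->
  vmeasurable U -> measurable_fun setT (fun y => h (U y) y).
Proof.
move=> ch mh mU.
pose q (k : nat) (y : Y) : 'rV[int]_d := \row_j Num.floor (k.+1%:R * U y ord0 j).
pose a (k : nat) (z : 'rV[int]_d) : 'rV[R]_d := \row_j ((z ord0 j)%:~R / k.+1%:R).
apply: (@measurable_fun_cvg _ _ _ _ (fun k y => h (a k (q k y)) y)).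
- move=> k _ B mB; rewrite setTI.
  have -> : (fun y => h (a k (q k y)) y) @^-1` B =
      \bigcup_(z : 'rV[int]_d) ([set y | q k y = z] `&` (h (a k z) @^-1` B)).
    apply/seteqP; split=> y /=.
      by move=> By; exists (q k y).
    by case=> z _ [/= <-].
  apply: countable_bigcupT_measurable => [|z]; first exact: countableP.
  apply: measurableI; last first.
    by rewrite -[X in measurable X]setTI; exact: mh.
  have -> : [set y | q k y = z] = \bigcap_(j in [set: 'I_d])
     ((fun y => k.+1%:R * U y ord0 j) @^-1` `[(z ord0 j)%:~R, (z ord0 j + 1)%:~R[%classic).
    apply/seteqP; split=> y /=.
      by move=> <- j _ /=; rewrite in_itv/= mxE floor_itv.
    move=> H; apply/rowP => j; rewrite mxE; apply: floor_def.
    by have := H j I; rewrite /= in_itv.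
  apply: fin_bigcap_measurable => // j _.
  rewrite -[X in measurable X]setTI.
  have mkU : measurable_fun setT (fun y => k.+1%:R * U y ord0 j).
    by apply: measurable_funM => //; exact: measurable_cst.
  by apply: mkU => //; exact: measurable_itv.
- move=> y _; apply: (@cvg_comp _ _ _ (fun k => a k (q k y)) (h^~ y) _ (nbhs (U y))); last exact: ch.
  apply/cvgrPdist_le => e e0; near=> k.
  rewrite [`|_|]mx_normrE; apply/bigmax_leP; split; first exact: ltW.
  case=> i j _ /=; rewrite !mxE ord1.
  have k0 : 0 < k.+1%:R :> R by [].
  have /andP[h1 h2] := floor_itv (k.+1%:R * U y ord0 j).
  have -> : U y ord0 j - (Num.floor (k.+1%:R * U y ord0 j))%:~R / k.+1%:R =
     (k.+1%:R * U y ord0 j - (Num.floor (k.+1%:R * U y ord0 j))%:~R) / k.+1%:R.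
     by field; rewrite addrC natr1 gt_eqF.
  rewrite ger0_norm ?divr_ge0 ?subr_ge0 ?ler0n// ler_pdivrMr//.
  move: h2; rewrite intrD => h2.
  apply: (@le_trans _ _ 1); first lra.
  rewrite -ler_pdivrMl// mulr1 (@le_trans _ _ k%:R) ?ler_nat//.
  near: k; exact: nbhs_infty_ger.
Unshelve. all: by end_near.
Qed.

End measurable_vectors.

Section measurable_gradient.
Context {R : realType} {dY : measure_display} {Y : measurableType dY}.

(* Partial derivatives are limits of difference quotients along [1 / (k + 1)]. *)
Lemma vmeasurable_gradient {d} (h : 'rV[R]_d -> Y -> R) (U : Y -> 'rV[R]_d) :
  (forall u y, differentiable (h^~ y) u) ->
  (forall u, measurable_fun setT (h u)) -> vmeasurable U ->
  vmeasurable (fun y => gradient (h^~ y) (U y)).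
Proof.
move=> dh mh mU j; under eq_fun do rewrite mxE.
have mhU (e : R) : measurable_fun setT
    (fun y => h (e *: delta_mx ord0 j + U y) y).
  apply: (@measurable_fun_caratheodory _ _ _ _ h (fun y => e *: delta_mx ord0 j + U y)) => //.
    by move=> y u; apply: differentiable_continuous; exact: dh.
  by apply: vmeasurableD => //; exact: vmeasurable_cst.
apply: (@measurable_fun_cvg _ _ _ _ (fun k y => (k.+1%:R^-1)^-1 *
    (h (k.+1%:R^-1 *: delta_mx ord0 j + U y) y - h (U y) y))).
  move=> k; apply: measurable_funM; first exact: measurable_cst.
  apply: measurable_funB => //.
  by have := mhU 0; under eq_fun do rewrite scale0r add0r.
move=> y _.
have /(@diff_derivable _ _ _ _ _ (delta_mx ord0 j)) := dh (U y) y.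
rewrite /derivable => /cvg_ex[l hl].
have -> : 'D_(delta_mx ord0 j) (h^~ y) (U y) = l by exact: cvg_lim.
apply: (@cvg_comp _ _ _ (fun k : nat => k.+1%:R^-1 : R) _ _ _ _ _ hl).
move=> A [e e0 eA].
apply: (filterS _ (near_infty_natSinv_lt (PosNum e0))) => k /= ke.
by apply: eA; rewrite /= ?invr_neq0// sub0r normrN ger0_norm.
Qed.

End measurable_gradient.

(** * Expectations and independence *)

Section expectations.
Context {R : realType} {dO : measure_display} {Omega : measurableType dO}.
Variable P : probability Omega R.
Implicit Types (f g : Omega -> R).

Definition rintegrable f : Prop := P.-integrable setT (EFin \o f).
Definition mean f : R := \int[P]_w f w.

Lemma rintegrable_measurable f : rintegrable f -> measurable_fun setT f.
Proof. by case/integrableP => /measurable_EFinP. Qed.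

Lemma rintegrable_cst (c : R) : rintegrable (fun=> c).
Proof. exact: finite_measure_integrable_cst. Qed.

Lemma rintegrableD f g : rintegrable f -> rintegrable g ->
  rintegrable (fun w => f w + g w).
Proof. exact: integrableD. Qed.

Lemma rintegrableZ (c : R) f : rintegrable f -> rintegrable (fun w => c * f w).
Proof. exact: integrableZl. Qed.

Lemma rintegrableB f g : rintegrable f -> rintegrable g ->
  rintegrable (fun w => f w - g w).
Proof. exact: integrableB. Qed.

Lemma rintegrable_sum (I : Type) (r : seq I) (Q : pred I) (f : I -> Omega -> R) :
  (forall i, Q i -> rintegrable (f i)) ->
  rintegrable (fun w => \sum_(i <- r | Q i) f i w).
Proof.
move=> fi; elim: r => [|i r IH].
  by under eq_fun do rewrite big_nil; exact: rintegrable_cst.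
under eq_fun do rewrite big_cons; case Qi: (Q i) => //.
by apply: rintegrableD => //; exact: fi.
Qed.

Lemma rintegrable_le f g : measurable_fun setT f -> (forall w, `|f w| <= g w) ->
  rintegrable g -> rintegrable f.
Proof.
move=> mf fg; apply: le_integrable => //; first exact/measurable_EFinP.
by move=> w _ /=; rewrite lee_fin (le_trans (fg w))// ler_norm.
Qed.

Lemma meanE f : rintegrable f -> (\int[P]_w (f w)%:E)%E = (mean f)%:E.
Proof. by move=> fi; rewrite fineK//; exact: integrable_fin_num. Qed.

Lemma mean_cst (c : R) : mean (fun=> c) = c.
Proof. 
rewrite /mean Rintegral_cst// [X in fine X](_ : _ = 1%E) ?mulr1//.
exact: probability_setT.
 Qed.

Lemma meanD f g : rintegrable f -> rintegrable g ->
  mean (fun w => f w + g w) = mean f + mean g.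
Proof. by move=> fi gi; rewrite /mean RintegralD. Qed.

Lemma meanB f g : rintegrable f -> rintegrable g ->
  mean (fun w => f w - g w) = mean f - mean g.
Proof. by move=> fi gi; rewrite /mean RintegralB. Qed.

Lemma meanZ (c : R) f : rintegrable f -> mean (fun w => c * f w) = c * mean f.
Proof. by move=> fi; rewrite /mean RintegralZl. Qed.

Lemma mean_sum (I : Type) (r : seq I) (Q : pred I) (f : I -> Omega -> R) :
  (forall i, Q i -> rintegrable (f i)) ->
  mean (fun w => \sum_(i <- r | Q i) f i w) = \sum_(i <- r | Q i) mean (f i).
Proof.
move=> fi; elim: r => [|i r IH].
  by under eq_fun do rewrite big_nil; rewrite mean_cst big_nil.
under eq_fun do rewrite big_cons; rewrite big_cons; case Qi: (Q i) => //.
by rewrite meanD ?IH//; [exact: fi|exact: rintegrable_sum].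
Qed.

Lemma mean_le f g : rintegrable f -> rintegrable g -> (forall w, f w <= g w) ->
  mean f <= mean g.
Proof. by move=> fi gi fg; apply: le_Rintegral. Qed.

Lemma mean_ge0 f : (forall w, 0 <= f w) -> 0 <= mean f.
Proof. by move=> f0; apply: Rintegral_ge0. Qed.

(** The variance hypotheses bound an extended-real expectation and say nothing about integrability;
    for a nonnegative function the finite bound yields it. *)
Lemma rintegrable_ge0_bound f (c : R) : measurable_fun setT f ->
  (forall w, 0 <= f w) -> (\int[P]_w (f w)%:E <= c%:E)%E ->
  rintegrable f /\ mean f <= c.
Proof.
move=> mf f0 fc; have fi : rintegrable f.
  apply/integrableP; split; first exact/measurable_EFinP.
  rewrite (le_lt_trans _ (ltry c))// (le_trans _ fc)//.
  by under eq_integral do rewrite /= ger0_norm//.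
by split=> //; rewrite -lee_fin -meanE.
Qed.

Definition vL2 {d} (U : Omega -> 'rV[R]_d) : Prop :=
  vmeasurable U /\ rintegrable (fun w => dot (U w) (U w)).

Section square_integrable.
Context {d : nat}.
Implicit Types (U V : Omega -> 'rV[R]_d).

Lemma vL2_le U (f : Omega -> R) : vmeasurable U ->
  (forall w, dot (U w) (U w) <= f w) -> rintegrable f -> vL2 U.
Proof.
move=> mU Uf fi; split=> //; apply: rintegrable_le fi; first exact: measurable_dot.
by move=> w; rewrite ger0_norm// dot_ge0.
Qed.

Lemma vL2_cst (u : 'rV[R]_d) : vL2 (fun=> u).
Proof. by split; [exact: vmeasurable_cst|exact: rintegrable_cst]. Qed.

Lemma vL2D U V : vL2 U -> vL2 V -> vL2 (fun w => U w + V w).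
Proof.
move=> [mU U2] [mV V2]; apply: vL2_le (fun w => dot_sqrD_le (U w) (V w)) _.
  exact: vmeasurableD.
by apply: rintegrableD; exact: rintegrableZ.
Qed.

Lemma vL2Z (c : R) U : vL2 U -> vL2 (fun w => c *: U w).
Proof.
move=> [mU U2]; split; first exact: vmeasurableZ.
under eq_fun do rewrite dotZl dotZr.
by do 2 apply: rintegrableZ.
Qed.

Lemma vL2B U V : vL2 U -> vL2 V -> vL2 (fun w => U w - V w).
Proof.
move=> U2 V2; under eq_fun do rewrite -scaleN1r.
by apply: vL2D => //; exact: vL2Z.
Qed.

Lemma vL2_sum (I : Type) (r : seq I) (Q : pred I) (f : I -> Omega -> 'rV[R]_d) :
  (forall i, Q i -> vL2 (f i)) -> vL2 (fun w => \sum_(i <- r | Q i) f i w).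
Proof.
move=> fi; elim: r => [|i r IH].
  by under eq_fun do rewrite big_nil; exact: vL2_cst.
under eq_fun do rewrite big_cons; case Qi: (Q i) => //.
by apply: vL2D => //; exact: fi.
Qed.

Lemma rintegrable_dot U V : vL2 U -> vL2 V -> rintegrable (fun w => dot (U w) (V w)).
Proof.
move=> [mU U2] [mV V2].
have h : rintegrable (fun w => 2^-1 * dot (U w) (U w) + 2^-1 * dot (V w) (V w)).
  by apply: rintegrableD; exact: rintegrableZ.
apply: rintegrable_le h; first exact: measurable_dot.
move=> w; rewrite ler_norml; apply/andP; split.
  have := dot_young (- U w) (V w) (@ltr01 R).
  rewrite !dotNl dotNr; lra.
have := dot_young (U w) (V w) (@ltr01 R); lra.
Qed.

(** Pythagoras in mean square: only the diagonal survives, so the bound grows like [#|A|] instead of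
    its square. This is where averaging reduces the noise. *)
Lemma mean_dot_orthogonal_sum (I : finType) (A : {set I})
    (f : I -> Omega -> 'rV[R]_d) (c : R) :
  (forall i, vL2 (f i)) ->
  (forall i, mean (fun w => dot (f i w) (f i w)) <= c) ->
  (forall i j, i != j -> mean (fun w => dot (f i w) (f j w)) = 0) ->
  mean (fun w => dot (\sum_(i in A) f i w) (\sum_(i in A) f i w)) <= #|A|%:R * c.
Proof.
move=> f2 fc f0.
under [X in mean X]eq_fun do
  (rewrite dot_suml; under eq_bigr do rewrite dot_sumr).
rewrite mean_sum => [|i _]; last first.
  by apply: rintegrable_sum => j _; exact: rintegrable_dot.
rewrite mulr_natl -sumr_const; apply: ler_sum => i iA.
rewrite mean_sum => [|j _]; last exact: rintegrable_dot.
rewrite (bigD1 i)//= big1 ?addr0// => j /andP[_ ji].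
by rewrite f0// eq_sym.
Qed.

End square_integrable.
End expectations.

Section independence.
Context {R : realType} {dO dX : measure_display}.
Context {Omega : measurableType dO} {X : measurableType dX}.
Context {P : probability Omega R} {D : probability X R}.
Context {xi : {mfun Omega >-> X}} {G : set (set Omega)}.
Hypothesis G_measurable : forall A, G A -> measurable A.
Hypothesis GI : setI_closed G.
Hypothesis GT : G setT.
Hypothesis G_indep : forall A B, G A -> measurable B ->
  P (A `&` xi @^-1` B) = (P A * D B)%E.

Let measurable_sigmaG A : <<s G >> A -> measurable A.
Proof.
apply: smallest_sub => //; exact: sigma_algebra_measurable.
Qed.

(** For fixed [B] both sides are finite measures in [A] that agree on the pi-system [G], hence on
    the sigma-algebra it generates. The right-hand side is [P] scaled by the real number [D B]. *)
Let sigmaG_indep A B : <<s G >> A -> measurable B ->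
  P (A `&` xi @^-1` B) = (P A * D B)%E.
Proof.
move=> GA mB.
have mxB : measurable (xi @^-1` B) by exact: measurable_funPTI.
have DBfin : (fine (D B) >= 0)%R by apply: fine_ge0; exact: measure_ge0.
have [r DBE] : exists r : {nonneg R}, D B = r%:num%:E.
  by exists (NngNum DBfin); rewrite /= fineK// fin_num_measure.
rewrite muleC DBE.
pose m2 := mscale r P.
apply: (@g_sigma_algebra_measure_unique _ _ _ G _ (fun=> setT) _ _ (mrestr P mxB) m2) => //.
- by rewrite bigcup_const//; exists 0%N.
- move=> A' GA'; transitivity (P A' * D B)%E; first exact: G_indep.
  by rewrite muleC DBE.
- move=> _; rewrite /= /mrestr ltey_eq; apply/orP; left; apply: fin_num_measure; exact: measurableI.
Qed.

(** The restriction of [P] to the past is obtained as the law of the identity map into the coarser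
    space. *)
Let idG : Omega -> g_sigma_algebraType G := id.

Let measurable_idG : measurable_fun setT idG.
Proof. by move=> _ A mA; rewrite setTI; exact: measurable_sigmaG. Qed.

Let idG_mfun : {mfun Omega >-> g_sigma_algebraType G} := mfun_Sub (mem_set measurable_idG).

Let measurable_joint : measurable_fun setT (fun w => (idG w, xi w)).
Proof. by apply: measurable_fun_pair => //; exact: measurable_idG. Qed.

Let joint_mfun : {mfun Omega >-> (g_sigma_algebraType G * X)%type} :=
  mfun_Sub (mem_set measurable_joint).

Let PG : probability (g_sigma_algebraType G) R := distribution P idG_mfun.

Let joint_distribution A : measurable A ->
  (PG \x D)%E A = distribution P joint_mfun A.
Proof.
apply: product_measure_unique => A' B mA mB.
by rewrite /= /PG /distribution /pushforward/=; exact: sigmaG_indep.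
Qed.

(* [G] generates the past, and a function of the past is a function measurable on
   [g_sigma_algebraType G]; with values there, [(w, xi w)] has law [P \x D]. *)
Lemma ge0_integral_indep (phi : g_sigma_algebraType G * X -> \bar R) :
  measurable_fun setT phi -> (forall z, 0 <= phi z)%E ->
  (\int[P]_w phi ((w : g_sigma_algebraType G), xi w) =
   \int[P]_w \int[D]_x phi ((w : g_sigma_algebraType G), x))%E.
Proof.
move=> mphi phi0.
transitivity (\int[PG \x D]_z phi z)%E.
  rewrite (@eq_measure_integral _ _ _ _ (distribution P joint_mfun)); last first.
    by move=> A mA _; exact: joint_distribution.
  by rewrite ge0_integral_distribution.
rewrite fubini_tonelli1// /PG ge0_integral_distribution//.
  exact: measurable_fun_fubini_tonelli_F.
by move=> y; exact: integral_ge0.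
Qed.

(** Version for signed functions: integrability along the run carries over to the product law, where
    Fubini freezes the past and integrates the fresh sample first. *)
Lemma integral_indep (phi : g_sigma_algebraType G * X -> \bar R) :
  measurable_fun setT phi ->
  P.-integrable setT (fun w => phi ((w : g_sigma_algebraType G), xi w)) ->
  (\int[P]_w phi ((w : g_sigma_algebraType G), xi w) =
   \int[P]_w \int[D]_x phi ((w : g_sigma_algebraType G), x))%E.
Proof.
move=> mphi iphi.
have iprod : (PG \x D)%E.-integrable setT phi.
  apply/integrableP; split=> //.
  rewrite (@eq_measure_integral _ _ _ _ (distribution P joint_mfun)); last first.
    by move=> A mA _; exact: joint_distribution.
  rewrite ge0_integral_distribution//; last exact: measurableT_comp.
  by case/integrableP : iphi.
transitivity (\int[PG \x D]_z phi z)%E.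
  rewrite (@eq_measure_integral _ _ _ _ (distribution P joint_mfun)); last first.
    by move=> A mA _; exact: joint_distribution.
  by rewrite integral_distribution.
have /integrableP[mF iF] := integrable_fubini_F iprod.
rewrite -integral12_prod_meas1// /PG integral_distribution//.
apply/integrableP; split; first exact: (measurableT_comp mF).
move: iF; rewrite /PG ge0_integral_distribution//; exact: measurableT_comp.
Qed.

End independence.

Section independent_noise.
Context {R : realType} {dO dX : measure_display}.
Context {Omega : measurableType dO} {X : measurableType dX}.
Context {P : probability Omega R} {D : probability X R}.
Context {xi : {mfun Omega >-> X}} {G : set (set Omega)}.
Hypothesis G_measurable : forall A, G A -> measurable A.
Hypothesis GI : setI_closed G.
Hypothesis GT : G setT.
Hypothesis G_indep : forall A B, G A -> measurable B ->
  P (A `&` xi @^-1` B) = (P A * D B)%E.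

Lemma measurable_fun_sigma {dZ} {Z : measurableType dZ} (f : Omega -> Z) :
  measurable_fun [set: g_sigma_algebraType G] f -> measurable_fun [set: Omega] f.
Proof.
move=> mf _ B mB; have := mf measurableT B mB; rewrite !setTI.
apply: smallest_sub => //; exact: sigma_algebra_measurable.
Qed.

Context {d : nat} (H : g_sigma_algebraType G * X -> 'rV[R]_d).
Hypothesis mH : vmeasurable H.

Let N (w : Omega) := H ((w : g_sigma_algebraType G), xi w).

Let measurable_joint : measurable_fun [set: Omega]
  (fun w => ((w : g_sigma_algebraType G), xi w)).
Proof.
apply: measurable_fun_pair; last exact: measurable_funP.
exact: (@measurable_fun_sigma _ (g_sigma_algebraType G) id).
Qed.

Lemma vmeasurable_noise : vmeasurable N.
Proof. by move=> j; exact: (measurableT_comp (mH j) measurable_joint). Qed.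

(** The variance bound holds for each frozen past [w], so Tonelli gives it for the joint law as
    well. *)
Lemma noise_vL2 (s : R) :
  (forall w, \int[D]_x (dot (H (w, x)) (H (w, x)))%:E <= s%:E)%E ->
  vL2 P N /\ mean P (fun w => dot (N w) (N w)) <= s.
Proof.
move=> Hs; have mN := vmeasurable_noise.
have [] := @rintegrable_ge0_bound _ _ _ P (fun w => dot (N w) (N w)) s.
- exact: measurable_dot.
- by move=> w; exact: dot_ge0.
- rewrite (@ge0_integral_indep _ _ _ _ _ P D xi G _ _ _ _
    (fun z => (dot (H z) (H z))%:E))//; last 2 first.
  + by apply/measurable_EFinP; exact: measurable_dot.
  + by move=> z; rewrite lee_fin dot_ge0.
  rewrite -[leRHS]mule1 -(@probability_setT _ _ _ P) -integral_cst//.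
  apply: ge0_le_integral => //.
  + by move=> w _; apply: integral_ge0 => x _; rewrite lee_fin dot_ge0.
  + apply: measurable_fun_sigma.
    apply: (measurable_fun_fubini_tonelli_F (fun z => (dot (H z) (H z))%:E)) => //.
      by apply/measurable_EFinP; exact: measurable_dot.
    by move=> z; rewrite lee_fin dot_ge0.
by [].
Qed.

(** With the past frozen, [Y] is a constant vector and the inner integral over the sample vanishes
    coordinate by coordinate. *)
Lemma noise_orthogonal (Y : Omega -> 'rV[R]_d) :
  (forall w j, D.-integrable setT (fun x => (H (w, x) ord0 j)%:E) /\
               (\int[D]_x (H (w, x) ord0 j)%:E = 0)%E) ->
  vmeasurable (Y : g_sigma_algebraType G -> _) ->
  vL2 P Y -> vL2 P N -> mean P (fun w => dot (Y w) (N w)) = 0.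
Proof.
move=> H0 mY Y2 N2.
rewrite /mean /Rintegral.
pose phi (z : g_sigma_algebraType G * X) : \bar R := (dot (Y z.1) (H z))%:E.
have mphi : measurable_fun setT phi.
  apply/measurable_EFinP; apply: measurable_dot => // j.
  exact: (measurableT_comp (mY j) measurable_fst).
have := integral_indep G_measurable GI GT G_indep mphi (rintegrable_dot Y2 N2).
rewrite /phi/= => ->; rewrite integral0_eq// => w _.
under eq_integral do rewrite -sumEFin.
rewrite integral_sum//; last first.
  move=> j; under eq_fun do rewrite EFinM.
  by apply: integrableZl => //; have [] := H0 w j.
rewrite big1// => j _.
under eq_integral do rewrite EFinM.
by have [h1 h2] := H0 w j; rewrite integralZl// h2 mule0.
Qed.

End independent_noise.

Section past.
Context {R : realType} {dO : measure_display} {Omega : measurableType dO}.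
Context {P : probability Omega R} {I : finType}.
Variable Gen : I -> set (set Omega).
Hypothesis Gen_measurable : forall i A, Gen i A -> measurable A.
Hypothesis GenI : forall i, setI_closed (Gen i).
Hypothesis GenT : forall i, Gen i setT.

(** A pi-system generating the joint sigma-algebra of the sources in [J]. Its elements have exactly
    the shape on which mutual independence is stated. *)
Definition cylinders (J : {set I}) : set (set Omega) :=
  [set \bigcap_(i in [set` J]) E i | E in [set E | forall i, i \in J -> Gen i (E i)]].

Lemma cylinders_measurable J A : cylinders J A -> measurable A.
Proof.
case=> E GE <-; apply: fin_bigcap_measurable => // i iJ.
by apply: (Gen_measurable (i := i)); exact: GE.
Qed.

Lemma cylindersI J : setI_closed (cylinders J).
Proof.
move=> _ _ [E GE <-] [E' GE' <-]; exists (fun i => E i `&` E' i).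
  by move=> i iJ; apply: GenI; [exact: GE|exact: GE'].
by rewrite bigcapI.
Qed.

Lemma cylindersT J : cylinders J setT.
Proof.
by exists (fun=> setT) => [i _|]; [exact: GenT|rewrite bigcapT].
Qed.

Lemma cylinders_gen (J : {set I}) i A : i \in J -> Gen i A -> cylinders J A.
Proof.
move=> iJ GA; exists (fun k => if k == i then A else setT).
  by move=> k _; case: eqP => [->|_] //; exact: GenT.
apply/seteqP; split=> w /=.
  by move=> /(_ i iJ); rewrite eqxx.
by move=> Aw k _; case: eqP.
Qed.

(** Inserting [B] as the event of the extra source [a] turns the intersection into a cylinder over
    [a |: J]; comparing the product formulas over [a |: J] and over [J] isolates the factor
    [P B]. *)
Lemma cylinders_indep (J : {set I}) a A B : mutually_independent P Gen -> a \notin J ->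
  cylinders J A -> Gen a B -> P (A `&` B) = (P A * P B)%E.
Proof.
move=> ind aJ [E GE <-] GB.
pose E' i := if i == a then B else E i.
have E'E i : i \in J -> E' i = E i.
  by rewrite /E'; case: eqP => // -> aJ'; rewrite aJ' in aJ.
have -> : \bigcap_(i in [set` J]) E i `&` B = \bigcap_(i in [set` a |: J]) E' i.
  apply/seteqP; split=> w /=.
    move=> [Ew Bw] i /=; rewrite !inE => /orP[/eqP ->|iJ].
      by rewrite /E' eqxx.
    by rewrite E'E//; exact: Ew.
  move=> Ew; split.
    by move=> i iJ; have := Ew i; rewrite E'E//; apply; rewrite /= !inE [_ \in _]iJ orbT.
  by have := Ew a; rewrite /E' eqxx; apply; rewrite /= !inE eqxx.
rewrite ind => [|i]; last first.
  rewrite !inE => /orP[/eqP ->|iJ]; first by rewrite /E' eqxx.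
  by rewrite E'E//; exact: GE.
rewrite ind// big_setU1//= muleC; congr (_ * P _)%E; last by rewrite /E' eqxx.
by apply: eq_bigr => i iJ; rewrite E'E.
Qed.

End past.

(** * Measurability of the run *)

(** Used with the drawn set as selector: since it takes finitely many values, the selected vector is
    a finite sum of indicators times measurable vectors. *)
Lemma vmeasurable_select {R : realType} {dY : measure_display}
    {Y : measurableType dY} {d : nat} {I : finType} (s : Y -> I)
    (f : I -> Y -> 'rV[R]_d) :
  (forall i, measurable [set y | s y = i]) -> (forall i, vmeasurable (f i)) ->
  vmeasurable (fun y => f (s y) y).
Proof.
move=> ms mf.
have -> : (fun y => f (s y) y) =
    (fun y => \sum_i (\1_[set y | s y = i] y : R) *: f i y).
  apply/funext => y; rewrite (bigD1 (s y))//= big1 => [|i iy].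
    by rewrite indicE mem_set// scale1r addr0.
  rewrite indicE memNset ?scale0r//= => yi.
  by move: iy; rewrite yi eqxx.
apply: vmeasurable_sum => i j; under eq_fun do rewrite mxE.
apply: measurable_funM; last exact: mf.
exact: (@measurable_indic _ _ _ setT _ (ms i)).
Qed.

Section measurable_run.
Context {R : realType} {n du dv : nat}.
Context {dX : measure_display} {X : measurableType dX}.
Variable F : 'rV[R]_du -> 'rV[R]_dv -> X -> R.
Hypothesis measurable_F : forall u v, measurable_fun setT (F u v).
Hypothesis differentiable_F : forall u v x,
  differentiable (fun u' => F u' v x) u /\ differentiable (fun v' => F u v' x) v.
Context {dY : measure_display} {Y : measurableType dY}.

Section sample_gradients.
Variables (U : Y -> 'rV[R]_du) (V : Y -> 'rV[R]_dv) (x : Y -> X).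
Hypotheses (mU : vmeasurable U) (mV : vmeasurable V) (mx : measurable_fun setT x).

(** Joint continuity of [F] in both blocks is not at hand. The random [v] is inserted at fixed [u]
    by continuity in [v], and only then is the gradient in [u] taken at the random [u]. *)
Lemma vmeasurable_sample_nabla_u :
  vmeasurable (fun y => sample_nabla_u F (U y) (V y) (x y)).
Proof.
apply: (@vmeasurable_gradient _ _ _ _ (fun u y => F u (V y) (x y))) => //.
  by move=> u y; have [] := differentiable_F u (V y) (x y).
move=> u; apply: (@measurable_fun_caratheodory _ _ _ _ (fun v y => F u v (x y))) => //.
  move=> y v; apply: differentiable_continuous.
  by have [] := differentiable_F u v (x y).
by move=> v; exact: measurableT_comp.
Qed.

Lemma vmeasurable_sample_nabla_v :
  vmeasurable (fun y => sample_nabla_v F (U y) (V y) (x y)).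
Proof.
apply: (@vmeasurable_gradient _ _ _ _ (fun v y => F (U y) v (x y))) => //.
  by move=> v y; have [] := differentiable_F (U y) v (x y).
move=> v; apply: (@measurable_fun_caratheodory _ _ _ _ (fun u y => F u v (x y))) => //.
  move=> y u; apply: differentiable_continuous.
  by have [] := differentiable_F u v (x y).
by move=> u; exact: measurableT_comp.
Qed.

End sample_gradients.

Lemma local_stepsS (gamma_u gamma_v : R) u v (x : nat -> X) k :
  let s := local_steps F gamma_u gamma_v u v x k in
  local_steps F gamma_u gamma_v u v x k.+1 =
  (s.1 - gamma_u *: sample_nabla_u F s.1 s.2 (x k),
   s.2 - gamma_v *: sample_nabla_v F s.1 s.2 (x k)).
Proof. by rewrite /=; case: (local_steps _ _ _ _ _ _ _). Qed.

Lemma fedavgp_roundE m K (gamma_u gamma_v eta_u eta_v : R) (St : {set 'I_n})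
    (x : 'I_n -> nat -> X) (s : 'rV[R]_du * ('I_n -> 'rV[R]_dv)) :
  let out i := local_steps F gamma_u gamma_v s.1 (s.2 i) (x i) K in
  fedavgp_round F m K gamma_u gamma_v eta_u eta_v St x s =
  ((1 - eta_u) *: s.1 + (eta_u / m%:R) *: \sum_(i in St) (out i).1,
   fun i => if i \in St then (1 - eta_v) *: s.2 i + eta_v *: (out i).2 else s.2 i).
Proof. by case: s. Qed.

Variables (m K : nat) (gamma_u gamma_v eta_u eta_v : R).

Lemma vmeasurable_local_steps (U : Y -> 'rV[R]_du) (V : Y -> 'rV[R]_dv)
    (x : nat -> Y -> X) (k : nat) :
  vmeasurable U -> vmeasurable V ->
  (forall k', (k' < k)%N -> measurable_fun setT (x k')) ->
  let s y := local_steps F gamma_u gamma_v (U y) (V y) (x^~ y) k in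
  vmeasurable (fun y => (s y).1) /\ vmeasurable (fun y => (s y).2).
Proof.
move=> mU mV; elim: k => [|k IH] mx //.
have [mUk mVk] : vmeasurable (fun y => (local_steps F gamma_u gamma_v (U y) (V y) (x^~ y) k).1) /\
    vmeasurable (fun y => (local_steps F gamma_u gamma_v (U y) (V y) (x^~ y) k).2).
  by apply: IH => k' kk'; apply: mx; exact: ltnW.
split; under eq_fun do rewrite local_stepsS.
  apply: vmeasurableB => //; apply: vmeasurableZ.
  by apply: vmeasurable_sample_nabla_u => //; exact: mx.
apply: vmeasurableB => //; apply: vmeasurableZ.
by apply: vmeasurable_sample_nabla_v => //; exact: mx.
Qed.

(** The space [Y] is left arbitrary so that it can be [Omega] with a coarser sigma-algebra; the
    hypotheses therefore ask only for the samples and draws of rounds before [t]. *)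
Lemma vmeasurable_fedavgp (u0 : 'rV[R]_du) (v0 : 'I_n -> 'rV[R]_dv)
    (S : nat -> Y -> {set 'I_n}) (x : 'I_n -> nat -> nat -> Y -> X) (t : nat) :
  (forall i t' k, (t' < t)%N -> (k < K)%N -> measurable_fun setT (x i t' k)) ->
  (forall t' A, (t' < t)%N -> measurable [set y | S t' y = A]) ->
  let s y := fedavgp F m K gamma_u gamma_v eta_u eta_v u0 v0 (S^~ y)
               (fun i t' k => x i t' k y) t in
  vmeasurable (fun y => (s y).1) /\ forall i, vmeasurable (fun y => (s y).2 i).
Proof.
elim: t => [|t IH] mx mS.
  by split=> [|i]; exact: vmeasurable_cst.
pose s y := fedavgp F m K gamma_u gamma_v eta_u eta_v u0 v0 (S^~ y)
  (fun i t' k => x i t' k y) t.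
have [mU mV] : vmeasurable (fun y => (s y).1) /\ forall i, vmeasurable (fun y => (s y).2 i).
  apply: IH => [i t' k tt kK|t' A tt]; first by apply: mx => //; exact: ltnW.
  by apply: mS; exact: ltnW.
pose loc i y := local_steps F gamma_u gamma_v (s y).1 ((s y).2 i) (fun k => x i t k y) K.
have mloc i : vmeasurable (fun y => (loc i y).1) /\ vmeasurable (fun y => (loc i y).2).
  apply: (vmeasurable_local_steps (x := fun k y => x i t k y) mU (mV i)).
  by move=> k kK; exact: mx.
have mSt A : measurable [set y | S t y = A] by exact: mS.
have E y : fedavgp F m K gamma_u gamma_v eta_u eta_v u0 v0 (S^~ y)
    (fun i t' k => x i t' k y) t.+1 =
  ((1 - eta_u) *: (s y).1 + (eta_u / m%:R) *: \sum_(i in S t y) (loc i y).1,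
   fun i => if i \in S t y then (1 - eta_v) *: (s y).2 i + eta_v *: (loc i y).2
            else (s y).2 i).
  exact: fedavgp_roundE.
split=> [|i].
  under eq_fun do rewrite E.
  apply: vmeasurableD; first exact: vmeasurableZ.
  apply: vmeasurableZ.
  apply: (@vmeasurable_select _ _ _ _ _ (S t) (fun A y => \sum_(i in A) (loc i y).1)) => // A.
  by apply: vmeasurable_sum => i; have [] := mloc i.
under eq_fun do rewrite E.
apply: (@vmeasurable_select _ _ _ _ _ (S t) (fun A y => if i \in A then
  (1 - eta_v) *: (s y).2 i + eta_v *: (loc i y).2 else (s y).2 i)) => // A.
case: (i \in A) => //; apply: vmeasurableD; apply: vmeasurableZ => //.
by have [] := mloc i.
Qed.

End measurable_run.

(** * Sampling without replacement *)

Section draws.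
Context {R : realType} {n : nat}.
Variable m : nat.
Hypothesis mn : (1 <= m <= n)%N.
Implicit Types (phi psi : {set 'I_n} -> R).

Let bin_neq0 k : (k <= n)%N -> 'C(n, k)%:R != 0 :> R.
Proof. by move=> kn; rewrite pnatr_eq0 -lt0n bin_gt0. Qed.

Definition draw_prob (A : {set 'I_n}) : R :=
  if #|A| == m then 'C(n, m)%:R^-1 else 0.

Definition draw_mean phi : R := \sum_A draw_prob A * phi A.

Lemma draw_meanD phi psi :
  draw_mean (fun A => phi A + psi A) = draw_mean phi + draw_mean psi.
Proof. by rewrite -big_split/=; apply: eq_bigr => A _; rewrite mulrDr. Qed.

Lemma draw_meanZ (c : R) phi : draw_mean (fun A => c * phi A) = c * draw_mean phi.
Proof. by rewrite mulr_sumr; apply: eq_bigr => A _; rewrite mulrCA. Qed.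

Lemma draw_mean_le phi psi : (forall A : {set 'I_n}, #|A| = m -> phi A <= psi A) ->
  draw_mean phi <= draw_mean psi.
Proof.
move=> h; apply: ler_sum => A _; rewrite /draw_prob.
by case: eqP => [/h|]; rewrite ?mul0r// => /ler_wpM2l; apply; rewrite invr_ge0.
Qed.

Lemma draw_mean_sum (I : finType) (phi : I -> {set 'I_n} -> R) :
  draw_mean (fun A => \sum_i phi i A) = \sum_i draw_mean (phi i).
Proof.
rewrite exchange_big/=; apply: eq_bigr => A _; exact: mulr_sumr.
Qed.

(** The only counting argument: the [m]-subsets avoiding [B] are those of its complement. The
    inclusion probabilities of one and of two clients follow from it by complementation. *)
Let draw_mean_disjoint (B : {set 'I_n}) :
  draw_mean (fun A => (A \subset ~: B)%:R) = 'C(n - #|B|, m)%:R / 'C(n, m)%:R.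
Proof.
have -> : 'C(n - #|B|, m) = #|[set A : {set 'I_n} | A \subset ~: B & #|A| == m]|.
  by rewrite cards_draws [#|~: B|]cardsCs finset.setCK card_ord.
rewrite -sum1_card natr_sum mulr_suml big_mkcond/=; apply: eq_bigr => A _.
rewrite inE /draw_prob.
by case: ifP => Am; case: (A \subset _); rewrite ?mul0r ?mulr0 ?mul1r ?mulr1.
Qed.

Lemma draw_mean_cst (c : R) : draw_mean (fun=> c) = c.
Proof.
transitivity (c * draw_mean (fun A => (A \subset ~: (finset.set0 : {set 'I_n}))%:R)).
  rewrite -draw_meanZ; congr draw_mean; apply/funext => A.
  by rewrite finset.setC0 finset.subsetT mulr1.
case/andP: mn => _ mn'.
by rewrite draw_mean_disjoint cards0 subn0 divff ?mulr1// bin_neq0.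
Qed.

Let n_neq0 : n%:R != 0 :> R.
Proof. by rewrite pnatr_eq0 -lt0n; case/andP: mn => /leq_trans; apply. Qed.

Let mn' : (m <= n)%N. Proof. by case/andP: mn. Qed.

Let bin_ratio1 : 'C(n.-1, m)%:R / 'C(n, m)%:R = 1 - m%:R / n%:R :> R.
Proof.
have := congr1 (fun k : nat => k%:R : R) (mul_bin_down n m).
rewrite !natrM natrB// => h.
have := bin_neq0 mn'; have := n_neq0; move: h.
move: 'C(n, m)%:R 'C(n.-1, m)%:R (n%:R : R) => c c' x h x0 c0.
apply: (mulfI x0); rewrite mulrA h; field.
by rewrite x0 c0.
Qed.

Let bin_ratio2 : (1 < n)%N ->
  'C(n.-2, m)%:R / 'C(n, m)%:R =
    1 - 2 * (m%:R / n%:R) + m%:R * (m%:R - 1) / (n%:R * (n%:R - 1)) :> R.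
Proof.
move=> n1.
have n10 : n%:R - 1 != 0 :> R by rewrite subr_eq0 (eqr_nat R n 1) gtn_eqF.
have h : n%:R * (n%:R - 1) * 'C(n.-2, m)%:R =
    (n%:R - m%:R) * (n%:R - m%:R - 1) * 'C(n, m)%:R :> R.
  (* For [m = n] both sides are zero. It is treated apart because the natural subtraction [n.-1 - m]
     would be truncated there. *)
  have := mn'; rewrite leq_eqVlt => /predU1P[E|lt].
    rewrite E bin_small ?subrr ?mulr0 ?mul0r//.
    by case: (n) n1 => [|[|k]]//= _; exact: (ltnW (ltnSn k.+1)).
  have := congr1 (fun k : nat => k%:R : R) (mul_bin_down n.-1 m).
  have := congr1 (fun k : nat => k%:R : R) (mul_bin_down n m).
  have n1E : n.-1%:R = n%:R - 1 :> R.
    by rewrite -subn1 natrB//; exact: ltnW.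
  have mn1 : (m <= n.-1)%N by case: (n) lt.
  rewrite !natrM !natrB// n1E => h1 h2.
  by rewrite -mulrA h2 mulrCA h1; ring.
have := bin_neq0 mn'; have := n_neq0; move: h n10.
move: 'C(n, m)%:R 'C(n.-2, m)%:R (n%:R : R) => c c' x h n10 x0 c0.
have -> : c' = (x - m%:R) * (x - m%:R - 1) * c / (x * (x - 1)).
  by rewrite -h; field; rewrite x0 n10.
by field; rewrite x0 c0 n10.
Qed.

Let sub_setC1 (A : {set 'I_n}) i : (A \subset ~: [set i]%SET) = (i \notin A).
Proof. by rewrite -finset.disjoints_subset fintype.disjoint_sym finset.disjoints1. Qed.

Lemma draw_mean_in i : draw_mean (fun A => (i \in A)%:R) = m%:R / n%:R.
Proof.
have -> : (fun A : {set 'I_n} => (i \in A)%:R : R) =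
    (fun A => 1 + (- 1) * (A \subset ~: [set i]%SET)%:R).
  apply/funext => A; rewrite sub_setC1.
  by case: (i \in A) => /=; ring.
rewrite draw_meanD draw_meanZ draw_mean_cst draw_mean_disjoint cards1 subn1 bin_ratio1.
ring.
Qed.

Let ord_le1 : (n <= 1)%N -> forall i j : 'I_n, i = j.
Proof.
move=> n1 i j; apply: val_inj => /=.
have h (k : 'I_n) : k = 0%N :> nat.
  by apply/eqP; rewrite -leqn0 -ltnS (leq_trans (ltn_ord k)).
by rewrite !h.
Qed.

(** Inclusion-exclusion: the indicator that both are drawn is the sum of the two single indicators,
    minus one, plus the indicator that neither is drawn. *)
Lemma draw_mean_in2 i j : i != j ->
  draw_mean (fun A => (i \in A)%:R * (j \in A)%:R) =
    m%:R * (m%:R - 1) / (n%:R * (n%:R - 1)).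
Proof.
move=> ij; have n1 : (1 < n)%N.
  by rewrite ltnNge; apply: contraNN ij => /ord_le1 h; rewrite (h i j).
have -> : (fun A : {set 'I_n} => (i \in A)%:R * (j \in A)%:R : R) =
    (fun A => ((i \in A)%:R + (j \in A)%:R) + (-1 +
       (A \subset ~: [set i; j]%SET)%:R)).
  apply/funext => A.
  rewrite finset.setCU finset.subsetI !sub_setC1.
  by case: (i \in A); case: (j \in A) => /=; ring.
rewrite !draw_meanD draw_mean_cst draw_mean_disjoint cards2 ij !draw_mean_in.
rewrite subn2 bin_ratio2//; ring.
Qed.

Lemma draw_mean_sum_in (x : 'I_n -> R) :
  draw_mean (fun A => \sum_(i in A) x i) = m%:R / n%:R * \sum_i x i.
Proof.
transitivity (draw_mean (fun A => \sum_i (x i * (i \in A)%:R))).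
  congr draw_mean; apply/funext => A; rewrite big_mkcond/=.
  by apply: eq_bigr => i _; case: (i \in A); rewrite ?mulr1 ?mulr0.
rewrite draw_mean_sum mulr_sumr; apply: eq_bigr => i _.
by rewrite draw_meanZ draw_mean_in mulrC.
Qed.

(** Second moment of a mean sampled without replacement. With [q] the probability that a given pair
    is drawn, the off-diagonal terms are completed to [q] times the square of the full sum, and the
    diagonal keeps the weight [m / n - q]. The excess over the square of the full mean vanishes for
    full participation, [m = n]. *)
Lemma draw_mean_sqr_mean (d : nat) (x : 'I_n -> 'rV[R]_d) (b : R) :
  let xbar := n%:R^-1 *: \sum_i x i in
  n%:R^-1 * \sum_i dot (x i) (x i) <= b ^+ 2 + dot xbar xbar ->
  draw_mean (fun A => dot (m%:R^-1 *: \sum_(i in A) x i)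
                          (m%:R^-1 *: \sum_(i in A) x i)) <=
  dot xbar xbar + 2 * (n%:R - m%:R) / (m%:R * n%:R) * b ^+ 2.
Proof.
move=> xbar hb.
pose q := m%:R * (m%:R - 1) / (n%:R * (n%:R - 1)) : R.
pose s2 := \sum_i dot (x i) (x i).
have m0 : m%:R != 0 :> R by rewrite pnatr_eq0 -lt0n; case/andP: mn.
have xbarE : dot (\sum_i x i) (\sum_i x i) = n%:R ^+ 2 * dot xbar xbar.
  by rewrite /xbar dotZl dotZr; field.
have -> : draw_mean (fun A => dot (m%:R^-1 *: \sum_(i in A) x i)
                          (m%:R^-1 *: \sum_(i in A) x i)) =
    m%:R^-1 ^+ 2 * ((m%:R / n%:R - q) * s2 + q * (n%:R ^+ 2 * dot xbar xbar)).
  transitivity (m%:R^-1 ^+ 2 * draw_mean (fun A => \sum_i \sum_j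
      dot (x i) (x j) * ((i \in A)%:R * (j \in A)%:R))).
    rewrite -draw_meanZ; congr draw_mean; apply/funext => A.
    rewrite dotZl dotZr mulrA -expr2; congr (_ * _).
    rewrite dot_suml big_mkcond/=; apply: eq_bigr => i _.
    case: (i \in A); last by rewrite big1// => j _; rewrite mul0r mulr0.
    rewrite dot_sumr big_mkcond/=; apply: eq_bigr => j _.
    by case: (j \in A); rewrite mul1r ?mulr1 ?mulr0.
  congr (_ * _); rewrite draw_mean_sum -xbarE dot_suml /s2 !mulr_sumr -big_split/=.
  apply: eq_bigr => i _; rewrite draw_mean_sum dot_sumr (bigD1 i)//= [in RHS](bigD1 i)//=.
  rewrite draw_meanZ (_ : (fun A => _) = (fun A : {set 'I_n} => (i \in A)%:R)); last first.
    by apply/funext => A; case: (i \in A); rewrite ?mulr1 ?mulr0.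
  rewrite draw_mean_in mulrDr addrA -mulrDl subrK mulrC; congr (_ + _).
  rewrite mulr_sumr; apply: eq_bigr => j ji.
  by rewrite draw_meanZ draw_mean_in2 1?eq_sym// mulrC.
(* For [n = 1] the value [q = 0] comes from a division by zero. *)
have [n1|n1] := leqP n 1.
  have nE : n = 1%N by apply/eqP; rewrite eqn_leq n1; case/andP: mn => /leq_trans; apply.
  have mE : m = 1%N by apply/eqP; rewrite eqn_leq; case/andP: mn => -> /leq_trans ->.
  have s2E : s2 = n%:R ^+ 2 * dot xbar xbar.
    rewrite -xbarE /s2 dot_suml; apply: eq_bigr => i _.
    rewrite dot_sumr (bigD1 i)//= big1 ?addr0// => j.
    by rewrite (ord_le1 n1 j i) eqxx.
  rewrite s2E -mulrDl subrK nE mE subrr; lra.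
have n10 : 0 < n%:R - 1 :> R by rewrite subr_gt0 (ltr_nat R 1 n).
have n0 : 0 < n%:R :> R by rewrite lt_neqAle eq_sym n_neq0 ler0n.
have mp : 0 < m%:R :> R by rewrite lt_neqAle eq_sym m0 ler0n.
have nm : 0 <= n%:R - m%:R :> R by rewrite subr_ge0 ler_nat.
have s2le : s2 <= n%:R * (b ^+ 2 + dot xbar xbar).
  by rewrite -ler_pdivrMl.
have qE : m%:R / n%:R - q = m%:R / n%:R * ((n%:R - m%:R) / (n%:R - 1)).
  by rewrite /q; field; rewrite n_neq0 gt_eqF.
apply: (@le_trans _ _ (dot xbar xbar + (n%:R - m%:R) / (m%:R * (n%:R - 1)) * b ^+ 2)).
  apply: (@le_trans _ _ (m%:R^-1 ^+ 2 * ((m%:R / n%:R - q) *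
      (n%:R * (b ^+ 2 + dot xbar xbar)) + q * (n%:R ^+ 2 * dot xbar xbar)))).
    rewrite ler_pM2l ?exprn_gt0 ?invr_gt0// lerD2r ler_wpM2l// qE.
    by rewrite mulr_ge0// divr_ge0// ltW.
  rewrite le_eqVlt; apply/orP; left; apply/eqP; rewrite /q; field.
  by rewrite n_neq0 m0 gt_eqF.
(* The computation gives the factor [(n - m) / (m (n - 1))]; since [n >= 2], replacing [n - 1] by
   [n] costs at most a factor 2. *)
rewrite lerD2l ler_wpM2r ?sqr_ge0//.
rewrite ler_pdivrMr ?mulr_gt0// mulrAC ler_pdivlMr ?mulr_gt0//.
have n2 : 2 <= n%:R :> R by rewrite (ler_nat R 2 n).
rewrite -subr_ge0.
have -> : 2 * (n%:R - m%:R) * (m%:R * (n%:R - 1)) - (n%:R - m%:R) * (m%:R * n%:R) =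
  (n%:R - m%:R) * m%:R * (n%:R - 2) :> R by ring.
by rewrite !mulr_ge0// ?subr_ge0// ltW.
Qed.

End draws.

(** * One round averaged over the draw, for fixed samples *)

Section averaged_descent.
Context {R : realType} {n m du dv : nat}.
Variables (K : nat) (gamma L b f : R).
Variables (gu hu Nu : 'I_n -> 'rV[R]_du) (gv hv Nv : 'I_n -> 'rV[R]_dv).
Variables (drift : 'I_n -> R) (f_next : {set 'I_n} -> R).
Hypotheses (mn : (1 <= m <= n)%N) (K0 : (0 < K)%N).
Hypotheses (gamma0 : 0 < gamma) (L0 : 0 < L) (step : gamma * L * K%:R <= 32^-1).
Let gbar := n%:R^-1 *: \sum_i gu i.
Let mean_in {d} (x : 'I_n -> 'rV[R]_d) (A : {set 'I_n}) := m%:R^-1 *: \sum_(i in A) x i.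
Hypothesis dissimilarity :
  n%:R^-1 * \sum_i dot (gu i) (gu i) <= b ^+ 2 + dot gbar gbar.
Hypothesis drift_ge0 : forall i, 0 <= drift i.
Hypothesis drift_u : forall i,
  dot (hu i - K%:R *: gu i) (hu i - K%:R *: gu i) <= 2 * L ^+ 2 * K%:R * drift i.
Hypothesis drift_v : forall i,
  dot (hv i - K%:R *: gv i) (hv i - K%:R *: gv i) <= 2 * L ^+ 2 * K%:R * drift i.
Hypothesis descent : forall A : {set 'I_n}, #|A| = m -> f_next A <= f
  - gamma * dot gbar (mean_in (fun i => hu i + Nu i) A)
  - gamma / n%:R * (\sum_(i in A) dot (gv i) (hv i + Nv i))
  + L * gamma ^+ 2 * dot (mean_in (fun i => hu i + Nu i) A)
                         (mean_in (fun i => hu i + Nu i) A)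
  + L * gamma ^+ 2 / n%:R * (\sum_(i in A) dot (hv i + Nv i) (hv i + Nv i)).

Let Kp : 0 < K%:R :> R. Proof. by rewrite ltr0n. Qed.
Let mp : 0 < m%:R :> R. Proof. by rewrite ltr0n; case/andP: mn. Qed.
Let np : 0 < n%:R :> R.
Proof. by rewrite ltr0n; case/andP: mn => /leq_trans; apply. Qed.

(** Young with weight [K] on the deviation of [h] from [K *: g]: half of [K |y|^2] is given up, and
    the deviation costs its square over [2 K], which is at most [L^2 D]. *)
Let inner_le {d} (y g h N : 'rV[R]_d) (D : R) :
  dot (h - K%:R *: g) (h - K%:R *: g) <= 2 * L ^+ 2 * K%:R * D ->
  - dot y (h + N) <=
    - K%:R * dot y g + K%:R / 2 * dot y y + L ^+ 2 * D - dot y N.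
Proof.
move=> hD.
have -> : h + N = K%:R *: g + (h - K%:R *: g) + N
  by rewrite [_ + (h - _)]addrC subrK.
rewrite dotDr (dotDr _ (K%:R *: g)) dotZr.
have := dot_young (- y) (h - K%:R *: g) Kp.
rewrite dotNl dotNl dotNr opprK => hy.
have : (2 * K%:R)^-1 * dot (h - K%:R *: g) (h - K%:R *: g) <= L ^+ 2 * D.
  rewrite mulrC ler_pdivrMr ?mulr_gt0//; apply: le_trans hD _.
  by rewrite le_eqVlt; apply/orP; left; apply/eqP; ring.
lra.
Qed.

Let square_le {d} (g h N : 'rV[R]_d) (D : R) :
  dot (h - K%:R *: g) (h - K%:R *: g) <= 2 * L ^+ 2 * K%:R * D ->
  dot (h + N) (h + N) <=
    4 * K%:R ^+ 2 * dot g g + 8 * L ^+ 2 * K%:R * D + 2 * dot N N.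
Proof.
move=> hD; apply: (le_trans (dot_sqrD_le _ _)); rewrite lerD2r.
have := dot_sqrD_le (K%:R *: g) (h - K%:R *: g).
rewrite [_ + (h - _)]addrC subrK dotZl dotZr; lra.
Qed.

Let mean_inD {d} (x y : 'I_n -> 'rV[R]_d) A :
  mean_in (fun i => x i + y i) A = mean_in x A + mean_in y A.
Proof. by rewrite /mean_in big_split/= scalerDr. Qed.

Let mean_in_deviation (A : {set 'I_n}) : #|A| = m ->
  dot (mean_in hu A - K%:R *: mean_in gu A) (mean_in hu A - K%:R *: mean_in gu A)
  <= 2 * L ^+ 2 * K%:R * (m%:R^-1 * \sum_(i in A) drift i).
Proof.
move=> Am.
have -> : mean_in hu A - K%:R *: mean_in gu A =
    m%:R^-1 *: \sum_(i in A) (hu i - K%:R *: gu i).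
  by rewrite /mean_in sumrB scalerBr -scaler_sumr scalerA mulrC -scalerA.
rewrite dotZl dotZr.
have := dot_sqr_sum_le (mem A) (fun i => hu i - K%:R *: gu i).
rewrite Am => h1.
have h2 : \sum_(i in A) dot (hu i - K%:R *: gu i) (hu i - K%:R *: gu i) <=
    2 * L ^+ 2 * K%:R * \sum_(i in A) drift i.
  by rewrite mulr_sumr; apply: ler_sum => i _.
have h3 : m%:R^-1 * dot (\sum_(i in A) (hu i - K%:R *: gu i))
    (\sum_(i in A) (hu i - K%:R *: gu i)) <=
    2 * L ^+ 2 * K%:R * \sum_(i in A) drift i.
  by rewrite ler_pdivrMl//; apply: (le_trans h1); rewrite ler_pM2l.
by rewrite [leRHS]mulrCA ler_pM2l ?invr_gt0.
Qed.

Let f_next_le (A : {set 'I_n}) : #|A| = m -> f_next A <= f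
  + gamma / m%:R * (\sum_(i in A) (- K%:R * dot gbar (gu i) +
       K%:R / 2 * dot gbar gbar + L ^+ 2 * drift i - dot gbar (Nu i)))
  + gamma / n%:R * (\sum_(i in A) (- K%:R / 2 * dot (gv i) (gv i)
       + L ^+ 2 * drift i - dot (gv i) (Nv i)))
  + L * gamma ^+ 2 * (4 * K%:R ^+ 2 * dot (mean_in gu A) (mean_in gu A)
       + 8 * L ^+ 2 * K%:R * m%:R^-1 * (\sum_(i in A) drift i)
       + 2 * dot (mean_in Nu A) (mean_in Nu A))
  + L * gamma ^+ 2 / n%:R * (\sum_(i in A) (4 * K%:R ^+ 2 * dot (gv i) (gv i)
       + 8 * L ^+ 2 * K%:R * drift i + 2 * dot (Nv i) (Nv i))).
Proof.
move=> Am; apply: (le_trans (descent Am)).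
have h1 : - gamma * dot gbar (mean_in (fun i => hu i + Nu i) A) <=
    gamma / m%:R * (\sum_(i in A) (- K%:R * dot gbar (gu i) +
       K%:R / 2 * dot gbar gbar + L ^+ 2 * drift i - dot gbar (Nu i))).
  rewrite mulNr /mean_in dotZr mulrA -mulrN ler_pM2l ?divr_gt0// dot_sumr -sumrN.
  by apply: ler_sum => i _; exact: inner_le.
have h2 : - (gamma / n%:R * (\sum_(i in A) dot (gv i) (hv i + Nv i))) <=
    gamma / n%:R * (\sum_(i in A) (- K%:R / 2 * dot (gv i) (gv i)
       + L ^+ 2 * drift i - dot (gv i) (Nv i))).
  rewrite -[leLHS]mulrN ler_pM2l ?divr_gt0// -sumrN.
  apply: ler_sum => i _; have := inner_le (gv i) (Nv i) (drift_v i); lra.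
have h3 : L * gamma ^+ 2 * dot (mean_in (fun i => hu i + Nu i) A)
                         (mean_in (fun i => hu i + Nu i) A) <=
    L * gamma ^+ 2 * (4 * K%:R ^+ 2 * dot (mean_in gu A) (mean_in gu A)
       + 8 * L ^+ 2 * K%:R * m%:R^-1 * (\sum_(i in A) drift i)
       + 2 * dot (mean_in Nu A) (mean_in Nu A)).
  rewrite ler_pM2l ?mulr_gt0 ?exprn_gt0// mean_inD.
  have := square_le (mean_in Nu A) (mean_in_deviation Am); lra.
have h4 : L * gamma ^+ 2 / n%:R * (\sum_(i in A) dot (hv i + Nv i) (hv i + Nv i)) <=
    L * gamma ^+ 2 / n%:R * (\sum_(i in A) (4 * K%:R ^+ 2 * dot (gv i) (gv i)
       + 8 * L ^+ 2 * K%:R * drift i + 2 * dot (Nv i) (Nv i))).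
  rewrite ler_pM2l ?divr_gt0 ?mulr_gt0 ?exprn_gt0//.
  by apply: ler_sum => i _; exact: square_le.
lra.
Qed.

(** A statement about fixed vectors, that is, about one outcome of the samples; the terms linear in
    the noise are kept because they vanish only in expectation. The weight [m / n^2] of the personal
    gradients is [1 / n] from averaging the losses times the probability [m / n] of being drawn. *)
Lemma averaged_descent :
  draw_mean m f_next <= f
  - (gamma * K%:R / 2 - 4 * L * gamma ^+ 2 * K%:R ^+ 2) *
      (dot gbar gbar + m%:R / n%:R ^+ 2 * \sum_i dot (gv i) (gv i))
  + 8 * L * gamma ^+ 2 * K%:R ^+ 2 * ((n%:R - m%:R) / (m%:R * n%:R) * b ^+ 2)
  + 5 / 2 * gamma * L ^+ 2 * (n%:R^-1 * \sum_i drift i)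
  - gamma * dot gbar (n%:R^-1 *: \sum_i Nu i)
  - gamma * (m%:R / n%:R ^+ 2) * (\sum_i dot (gv i) (Nv i))
  + 2 * L * gamma ^+ 2 * (draw_mean m (fun A => dot (mean_in Nu A) (mean_in Nu A))
      + m%:R / n%:R ^+ 2 * \sum_i dot (Nv i) (Nv i)).
Proof.
apply: (le_trans (draw_mean_le f_next_le)).
rewrite !draw_meanD !draw_meanZ !draw_meanD !draw_meanZ.
rewrite (draw_mean_cst mn) !(draw_mean_sum_in mn).
have hq := draw_mean_sqr_mean mn dissimilarity.
rewrite -/gbar in hq.
rewrite !big_split/= !sumrN -!mulr_sumr.
have E1 : \sum_i dot gbar (gu i) = n%:R * dot gbar gbar.
  rewrite -dot_sumr (_ : \sum_i gu i = n%:R *: gbar) ?dotZr//.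
  by rewrite /gbar scalerA divff ?scale1r// gt_eqF.
have E2 : \sum_i dot gbar (Nu i) = n%:R * dot gbar (n%:R^-1 *: \sum_i Nu i).
  by rewrite -dot_sumr dotZr mulrA divff ?mul1r// gt_eqF.
rewrite E1 E2 !sumr_const card_ord -[_ *+ n]mulr_natl.
have P2 : 0 <= \sum_i drift i by apply: sumr_ge0.
have rho1 : m%:R / n%:R <= 1 :> R.
  by rewrite ler_pdivrMr// mul1r ler_nat; case/andP: mn.
have rho0 : 0 < m%:R / n%:R :> R by rewrite divr_gt0.
rewrite -/(mean_in gu) in hq.
rewrite -subr_ge0.
set X := dot gbar gbar in hq *; set Q1 := draw_mean m _ in hq *.
(* The constant [5 / 2] collects the drift: 1 from the inner product in [u], [m / n <= 1] from the
   one in [v], and [8 / 32 * 2 = 1 / 2] from the squared steps of both blocks. *)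
have c0 : 0 <= 5 / 2 - 1 - m%:R / n%:R - 8 * (gamma * L * K%:R) * (1 + m%:R / n%:R).
  have : 8 * (gamma * L * K%:R) * (1 + m%:R / n%:R) <= 8 * 32^-1 * 2.
    apply: ler_pM; [|by rewrite addr_ge0// ltW| |lra].
      by rewrite !mulr_ge0// ltW.
    by rewrite ler_pM2l.
  lra.
rewrite [X in 0 <= X](_ : _ = 4 * K%:R ^+ 2 * L * gamma ^+ 2 *
    (X + 2 * (n%:R - m%:R) / (m%:R * n%:R) * b ^+ 2 - Q1) +
  gamma * L ^+ 2 / n%:R * (\sum_i drift i) *
    (5 / 2 - 1 - m%:R / n%:R - 8 * (gamma * L * K%:R) * (1 + m%:R / n%:R))).
  by rewrite addr_ge0// !mulr_ge0// ?exprn_ge0 ?invr_ge0 ?subr_ge0// ltW.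
by field; rewrite !gt_eqF.
Qed.

End averaged_descent.

(** * Functions smooth in two blocks *)

Definition sqr_lipschitz {R : realType} {d1 d2 : nat} (L : R)
    (g : 'rV[R]_d1 -> 'rV[R]_d2) : Prop :=
  forall x y, dot (g x - g y) (g x - g y) <= L ^+ 2 * dot (x - y) (x - y).

Lemma elipschitz_sqr {R : realType} {d1 d2 : nat} (L0 L : R)
    (g : 'rV[R]_d1 -> 'rV[R]_d2) : L0 <= L -> elipschitz L0 g -> sqr_lipschitz L g.
Proof.
move=> L0L lip x y; rewrite -!enorm_sqr -exprMn.
have h : enorm (g x - g y) <= L * enorm (x - y).
  by apply: (le_trans (lip x y)); rewrite ler_wpM2r ?sqrtr_ge0.
by rewrite lerXn2r ?nnegrE ?sqrtr_ge0// (le_trans _ h) ?sqrtr_ge0.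
Qed.

Section two_blocks.
Context {R : realType} {du dv : nat}.
Variables (L : R) (f : 'rV[R]_du -> 'rV[R]_dv -> R).
Hypothesis L0 : 0 < L.
Local Notation gu := (nabla_u f).
Local Notation gv := (nabla_v f).

Hypothesis differentiable_f :
  forall u v, differentiable (f^~ v) u /\ differentiable (f u) v.
Hypotheses (lip_uu : forall v, sqr_lipschitz L (gu^~ v))
           (lip_uv : forall u, sqr_lipschitz L (gu u))
           (lip_vv : forall u, sqr_lipschitz L (gv u))
           (lip_vu : forall v, sqr_lipschitz L (gv^~ v)).

(** The step in [u] is made at [v + c], then the step in [v] at [u]. Moving the gradient in [u] back
    from [v + c] to [v] costs [L / 2] on each squared step by Young with weight [1 / L], which
    raises both coefficients from [L / 2] to [L]. *)
Lemma two_block_descent u v a c :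
  f (u + a) (v + c) <= f u v + dot (gu u v) a + dot (gv u v) c
                       + L * dot a a + L * dot c c.
Proof.
have h1 : f (u + a) (v + c) <= f u (v + c) + dot (gu u (v + c)) a + L / 2 * dot a a.
  apply: (@descent_quadratic _ _ (f^~ (v + c))) => //.
    by move=> y; have [] := differentiable_f y (v + c).
  by move=> y z; exact: (lip_uu (v + c)).
have h2 : f u (v + c) <= f u v + dot (gv u v) c + L / 2 * dot c c.
  apply: (@descent_quadratic _ _ (f u)) => //.
    by move=> y; have [] := differentiable_f u y.
  by move=> y z; exact: (lip_vv u).
have Li : 0 < L^-1 by rewrite invr_gt0.
have h3 : dot (gu u (v + c) - gu u v) a <= L / 2 * dot c c + L / 2 * dot a a.
  apply: (le_trans (dot_young _ _ Li)); rewrite (_ : (2 * L^-1)^-1 = L / 2); last first.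
    by field; rewrite gt_eqF.
  rewrite lerD2r.
  have := lip_uv u (v + c) v; rewrite addrAC subrr add0r => h.
  apply: (le_trans (ler_wpM2l _ h)); first by rewrite divr_ge0// ltW.
  by rewrite le_eqVlt; apply/orP; left; apply/eqP; field; rewrite gt_eqF.
move: h3; rewrite dotBl; lra.
Qed.

Let joint_lip {d} (g : 'rV[R]_du -> 'rV[R]_dv -> 'rV[R]_d) :
  (forall v, sqr_lipschitz L (g^~ v)) -> (forall u, sqr_lipschitz L (g u)) ->
  forall u u' v v', dot (g u v - g u' v') (g u v - g u' v') <=
    2 * L ^+ 2 * (dot (u - u') (u - u') + dot (v - v') (v - v')).
Proof.
move=> hu hv u u' v v'.
have -> : g u v - g u' v' = (g u v - g u' v) + (g u' v - g u' v').
  by rewrite addrA subrK.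
apply: (le_trans (dot_sqrD_le _ _)).
have := hu v u u'; have := hv u' v v' => /=; lra.
Qed.

Definition nabla_u_lipschitz := joint_lip lip_uu lip_uv.
Definition nabla_v_lipschitz := joint_lip lip_vu lip_vv.

Section measurability.
Context {dY : measure_display} {Y : measurableType dY}.
Variables (U : Y -> 'rV[R]_du) (V : Y -> 'rV[R]_dv).
Hypotheses (mU : vmeasurable U) (mV : vmeasurable V).

Let measurable_fV u : measurable_fun setT (fun y => f u (V y)).
Proof.
apply: (@measurable_fun_caratheodory _ _ _ _ (fun v (_ : Y) => f u v)) => //.
by move=> _ v; apply: differentiable_continuous; have [] := differentiable_f u v.
Qed.

Let measurable_Uf v : measurable_fun setT (fun y => f (U y) v).
Proof.
apply: (@measurable_fun_caratheodory _ _ _ _ (fun u (_ : Y) => f u v)) => //.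
by move=> _ u; apply: differentiable_continuous; have [] := differentiable_f u v.
Qed.

Lemma measurable_two_block : measurable_fun setT (fun y => f (U y) (V y)).
Proof.
apply: (@measurable_fun_caratheodory _ _ _ _ (fun u y => f u (V y))) => //.
by move=> y u; apply: differentiable_continuous; have [] := differentiable_f u (V y).
Qed.

Lemma vmeasurable_nabla_u : vmeasurable (fun y => gu (U y) (V y)).
Proof.
apply: (@vmeasurable_gradient _ _ _ _ (fun u y => f u (V y))) => //.
by move=> u y; have [] := differentiable_f u (V y).
Qed.

Lemma vmeasurable_nabla_v : vmeasurable (fun y => gv (U y) (V y)).
Proof.
apply: (@vmeasurable_gradient _ _ _ _ (fun v y => f (U y) v)) => //.
by move=> v y; have [] := differentiable_f (U y) v.
Qed.

End measurability.

Section integrability.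
Context {dO : measure_display} {Omega : measurableType dO}.
Variable P : probability Omega R.
Variables (U : Omega -> 'rV[R]_du) (V : Omega -> 'rV[R]_dv).
Hypotheses (U2 : vL2 P U) (V2 : vL2 P V).

Let vL2_lipschitz {d} (g : 'rV[R]_du -> 'rV[R]_dv -> 'rV[R]_d) :
  vmeasurable (fun w => g (U w) (V w)) ->
  (forall u u' v v', dot (g u v - g u' v') (g u v - g u' v') <=
    2 * L ^+ 2 * (dot (u - u') (u - u') + dot (v - v') (v - v'))) ->
  vL2 P (fun w => g (U w) (V w)).
Proof.
move=> mg lip.
have gE w : g (U w) (V w) = (g (U w) (V w) - g 0 0) + g 0 0 by rewrite subrK.
apply: (@vL2_le _ _ _ _ _ _ (fun w => 2 * (2 * L ^+ 2 * (dot (U w) (U w) +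
  dot (V w) (V w))) + 2 * dot (g 0 0) (g 0 0))) => //.
  move=> w; rewrite gE; apply: (le_trans (dot_sqrD_le _ _)); rewrite lerD2r.
  by have := lip (U w) 0 (V w) 0; rewrite !subr0; lra.
apply: rintegrableD; last exact: rintegrable_cst.
do 2 apply: rintegrableZ; apply: rintegrableD; [exact: U2.2|exact: V2.2].
Qed.

Lemma vL2_nabla_u : vL2 P (fun w => gu (U w) (V w)).
Proof.
by apply: vL2_lipschitz nabla_u_lipschitz; apply: vmeasurable_nabla_u; [exact: U2.1|exact: V2.1].
Qed.

Lemma vL2_nabla_v : vL2 P (fun w => gv (U w) (V w)).
Proof.
by apply: vL2_lipschitz nabla_v_lipschitz; apply: vmeasurable_nabla_v; [exact: U2.1|exact: V2.1].
Qed.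

(** The descent inequality from the origin to the random point bounds [f] above, and the one from
    the random point back to the origin bounds it below. Both bounds are integrable because the
    iterates and the gradients there are square integrable. *)
Lemma rintegrable_two_block : rintegrable P (fun w => f (U w) (V w)).
Proof.
pose q w := L * dot (U w) (U w) + L * dot (V w) (V w).
pose hi w := dot (gu 0 0) (U w) + dot (gv 0 0) (V w).
pose lo w := dot (gu (U w) (V w)) (U w) + dot (gv (U w) (V w)) (V w).
have iq : rintegrable P q.
  by apply: rintegrableD; apply: rintegrableZ; [exact: U2.2|exact: V2.2].
have ihi : rintegrable P hi.
  by apply: rintegrableD; apply: rintegrable_dot => //; exact: vL2_cst.
have ilo : rintegrable P lo.
  by apply: rintegrableD; apply: rintegrable_dot => //; [exact: vL2_nabla_u|exact: vL2_nabla_v].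
apply: (@rintegrable_le _ _ _ _ _ (fun w => `|f 0 0| + (`|hi w| + (`|lo w| + q w)))).
- by apply: measurable_two_block; [exact: U2.1|exact: V2.1].
- move=> w; have q0 : 0 <= q w by rewrite addr_ge0// mulr_ge0 ?dot_ge0// ltW.
  have := two_block_descent 0 0 (U w) (V w); rewrite !add0r => h1.
  have := two_block_descent (U w) (V w) (- U w) (- V w).
  rewrite !subrr !(dotNr, dotNl) !opprK => h2.
  have := ler_norm (f 0 0); have := ler_norm (- f 0 0).
  have := ler_norm (hi w); have := ler_norm (- hi w).
  have := ler_norm (lo w); have := ler_norm (- lo w).
  rewrite !normrN ler_norml; rewrite /hi /lo /q in h1 h2 q0 * => *.
  by apply/andP; split; lra.
- apply: rintegrableD; first exact: rintegrable_cst.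
  apply: rintegrableD; first exact: integrable_norm.
  by apply: rintegrableD => //; exact: integrable_norm.
Qed.

End integrability.
End two_blocks.

(** * Noise of the run *)

Section run_filtration.
Context {R : realType} {n du dv : nat} {dX dO : measure_display}.
Context {X : measurableType dX} {Omega : measurableType dO}.
Variables (D : 'I_n -> probability X R) (F : 'rV[R]_du -> 'rV[R]_dv -> X -> R).
Variable P : probability Omega R.
Variables (T K m : nat) (gamma_u gamma_v eta_u eta_v : R).
Variables (u0 : 'rV[R]_du) (v0 : 'I_n -> 'rV[R]_dv).
Variables (xi : 'I_n -> nat -> nat -> {mfun Omega >-> X})
          (S : nat -> Omega -> {set 'I_n}).
Hypothesis measurable_F : forall u v, measurable_fun setT (F u v).
Hypothesis differentiable_F : forall u v x,
  differentiable (fun u' => F u' v x) u /\ differentiable (fun v' => F u v' x) v.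
Hypothesis sampling : fedavgp_sampling D P m T K xi S.

Local Notation source := ('I_n * 'I_T * 'I_K + 'I_T)%type.
Local Notation events := (@run_events n dX X dO Omega T K xi S).

Let draw_measurable (t : 'I_T) A : measurable [set w | S t w = A].
Proof. by case: sampling => _ /(_ t A)[]. Qed.

Lemma run_events_measurable a A : events a A -> measurable A.
Proof.
case: a => [[[i t] k]|t] /= [B mB <-]; first exact: measurable_funPTI.
rewrite (_ : _ @^-1` _ = \bigcup_(A' in B) [set w | S t w = A']).
  by apply: fin_bigcup_measurable.
by apply/seteqP; split=> w /=; [exists (S t w)|case=> A' BA' /= ->].
Qed.

Lemma run_eventsI a : setI_closed (events a).
Proof.
case: a => [[[i t] k]|t] _ _ /= [B mB <-] [B' mB' <-]; exists (B `&` B') => //.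
exact: measurableI.
Qed.

Lemma run_eventsT a : events a setT.
Proof. by case: a => [[[i t] k]|t] /=; exists setT. Qed.

(** Pasts are indexed by sets of sources and not by time: the past of one client's sample contains
    samples of the other clients drawn at the same or a later local step, so the pasts in use do not
    form one chain. *)
Local Notation known J := (g_sigma_algebraType (cylinders events J)).

Lemma known_sample (J : {set source}) i (t : 'I_T) (k : 'I_K) :
  inl (i, t, k) \in J -> measurable_fun [set: known J] (xi i t k).
Proof.
move=> aJ _ B mB; rewrite setTI; apply: sub_sigma_algebra.
by apply: (cylinders_gen run_eventsT aJ) => /=; exists B.
Qed.

Lemma known_draw (J : {set source}) (t : 'I_T) (A : {set 'I_n}) :
  inr t \in J -> measurable ([set w | S t w = A] : set (known J)).
Proof.
move=> aJ; apply: sub_sigma_algebra.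
by apply: (cylinders_gen run_eventsT aJ) => /=; exists [set A].
Qed.

Definition iterate t w := fedavgp F m K gamma_u gamma_v eta_u eta_v u0 v0
  (S^~ w) (fun i t' k => xi i t' k w) t.

Definition local_iterate i t k w :=
  local_steps F gamma_u gamma_v (iterate t w).1 ((iterate t w).2 i)
    (fun k' => xi i t k' w) k.

Definition rounds_before t : {set source} :=
  [set a : source | match a with inl (_, t', _) => (t' < t)%N | inr t' => (t' < t)%N end]%SET.

(* The samples of round [t] are included: the local iterates are defined for
   every client, participating or not, and so do not depend on the draw [S t]. *)
Definition before_draw t : {set source} :=
  [set a : source | match a with inl (_, t', _) => (t' <= t)%N | inr t' => (t' < t)%N end]%SET.

(* The samples of the other clients in round [t] count as known, which makes the
   noises of distinct clients orthogonal. *)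
Definition before_sample i t k : {set source} :=
  [set a : source | match a with
           | inl (i', t', k') => (t' < t)%N || (t' == t :> nat) && ((i' != i) || (k' < k)%N)
           | inr t' => (t' < t)%N
           end]%SET.

Lemma rounds_before_draw t : rounds_before t \subset before_draw t.
Proof. by apply/fintype.subsetP => -[[[i t'] k]|t']; rewrite !inE// => /ltnW. Qed.

Lemma rounds_before_sample i t k : rounds_before t \subset before_sample i t k.
Proof. by apply/fintype.subsetP => -[[[i' t'] k']|t']; rewrite !inE// => ->. Qed.

(** Adaptedness of the run: the general measurability lemma applied on [Omega] with the
    sigma-algebra of the sources in [J]. *)
Lemma known_iterate (J : {set source}) t : (t <= T)%N -> rounds_before t \subset J ->
  vmeasurable ((fun w => (iterate t w).1) : known J -> _) /\
  forall i, vmeasurable ((fun w => (iterate t w).2 i) : known J -> _).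
Proof.
move=> tT /fintype.subsetP tJ.
apply: (vmeasurable_fedavgp measurable_F differentiable_F (Y := known J) m
  gamma_u gamma_v eta_u eta_v u0 v0 (x := xi) (S := S)) => //.
- move=> i t' k t't kK; have t'T := leq_trans t't tT.
  apply: (@known_sample J i (Ordinal t'T) (Ordinal kK)).
  by apply: tJ; rewrite inE.
- move=> t' A t't; have t'T := leq_trans t't tT.
  by apply: (@known_draw J (Ordinal t'T)); apply: tJ; rewrite inE.
Qed.

Lemma known_local_iterate (J : {set source}) i t k :
  (t < T)%N -> (k <= K)%N -> rounds_before t \subset J ->
  (forall (t' : 'I_T) (k' : 'I_K), t' = t :> nat -> (k' < k)%N -> inl (i, t', k') \in J) ->
  vmeasurable ((fun w => (local_iterate i t k w).1) : known J -> _) /\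
  vmeasurable ((fun w => (local_iterate i t k w).2) : known J -> _).
Proof.
move=> tT kK tJ kJ; have [mU mV] := known_iterate (ltnW tT) tJ.
apply: (vmeasurable_local_steps measurable_F differentiable_F (Y := known J)
  gamma_u gamma_v (x := fun k' => xi i t k')) => //.
move=> k' k'k; have k'K := leq_trans k'k kK.
by apply: (@known_sample J i (Ordinal tT) (Ordinal k'K)); exact: kJ.
Qed.

Section oracle.
Context {d : nat}.
Variables (gs : 'rV[R]_du -> 'rV[R]_dv -> X -> 'rV[R]_d)
          (gm : 'I_n -> 'rV[R]_du -> 'rV[R]_dv -> 'rV[R]_d) (sigma : R).
Hypothesis measurable_gs : forall dY (Y : measurableType dY)
  (U : Y -> 'rV[R]_du) (V : Y -> 'rV[R]_dv) (x : Y -> X),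
  vmeasurable U -> vmeasurable V -> measurable_fun setT x ->
  vmeasurable (fun y => gs (U y) (V y) (x y)).
Hypothesis measurable_gm : forall i dY (Y : measurableType dY)
  (U : Y -> 'rV[R]_du) (V : Y -> 'rV[R]_dv),
  vmeasurable U -> vmeasurable V -> vmeasurable (fun y => gm i (U y) (V y)).
Hypothesis unbiased : forall i u v, has_mean (D i) (gs u v) (gm i u v).
Hypothesis variance : forall i u v,
  ('E_(D i)[fun x => (enorm (gs u v x - gm i u v) ^+ 2)%R] <= (sigma ^+ 2)%:E)%E.

(** Generic in the sample gradient [gs] and its mean [gm], so that both blocks are instances. *)
Definition noise i t k w :=
  let s := local_iterate i t k w in
  gs s.1 s.2 (xi i t k w) - gm i s.1 s.2.

Section one_sample.
Variables (i : 'I_n) (t k : nat).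
Hypotheses (tT : (t < T)%N) (kK : (k < K)%N).
Local Notation J := (before_sample i t k).

Let mloc : vmeasurable ((fun w => (local_iterate i t k w).1) : known J -> _) /\
  vmeasurable ((fun w => (local_iterate i t k w).2) : known J -> _).
Proof.
apply: known_local_iterate => //; [exact: ltnW|exact: rounds_before_sample|].
by move=> t' k' tt' k'k; rewrite inE tt' eqxx k'k orbT orbT.
Qed.

Let H (z : known J * X) : 'rV[R]_d :=
  let s := local_iterate i t k z.1 in gs s.1 s.2 z.2 - gm i s.1 s.2.

Let measurable_H : vmeasurable H.
Proof.
have mU : vmeasurable (fun z : known J * X => (local_iterate i t k z.1).1).
  by move=> j; exact: (measurableT_comp (mloc.1 j) measurable_fst).
have mV : vmeasurable (fun z : known J * X => (local_iterate i t k z.1).2).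
  by move=> j; exact: (measurableT_comp (mloc.2 j) measurable_fst).
by apply: vmeasurableB; [exact: measurable_gs|exact: measurable_gm].
Qed.

Let indep A B : cylinders events J A -> measurable B ->
  P (A `&` xi i t k @^-1` B) = (P A * D i B)%E.
Proof.
move=> GA mB; case: sampling => distr _ ind.
rewrite -(distr i (Ordinal tT) (Ordinal kK) B mB).
apply: (cylinders_indep ind (a := inl (i, Ordinal tT, Ordinal kK))) GA _.
  by rewrite inE /= eqxx !ltnn eqxx.
by exists B.
Qed.

Lemma noise_square_integrable : vL2 P (noise i t k) /\
  mean P (fun w => dot (noise i t k w) (noise i t k w)) <= sigma ^+ 2.
Proof.
refine (@noise_vL2 _ _ _ _ _ P (D i) (xi i t k) _
  (@cylinders_measurable _ _ _ _ run_events_measurable J)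
  (@cylindersI _ _ _ _ run_eventsI J) (cylindersT run_eventsT J) indep
  _ H measurable_H _ _).
move=> w; have := variance i (local_iterate i t k w).1 (local_iterate i t k w).2.
by rewrite unlock; under eq_integral do rewrite enorm_sqr.
Qed.

Lemma noise_centered (Y : Omega -> 'rV[R]_d) : vmeasurable (Y : known J -> _) ->
  vL2 P Y -> mean P (fun w => dot (Y w) (noise i t k w)) = 0.
Proof.
move=> mY Y2.
refine (@noise_orthogonal _ _ _ _ _ P (D i) (xi i t k) _
  (@cylinders_measurable _ _ _ _ run_events_measurable J)
  (@cylindersI _ _ _ _ run_eventsI J) (cylindersT run_eventsT J) indep
  _ H measurable_H Y _ mY Y2 _).
  move=> w j; have := unbiased i (local_iterate i t k w).1 (local_iterate i t k w).2 j.
  move=> -[h1]; rewrite unlock => h2.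
  have -> : (fun x => (H (w, x) ord0 j)%:E) =
      (fun x => (gs (local_iterate i t k w).1 (local_iterate i t k w).2 x ord0 j)%:E -
        (gm i (local_iterate i t k w).1 (local_iterate i t k w).2 ord0 j)%:E)%E.
    by apply/funext => x; rewrite /H !mxE EFinB.
  have ic : (D i).-integrable setT
      (fun=> (gm i (local_iterate i t k w).1 (local_iterate i t k w).2 ord0 j)%:E).
    exact: finite_measure_integrable_cst.
  split; first exact: integrableB.
  rewrite integralB// h2.
  have -> : (\int[D i]_x (gm i (local_iterate i t k w).1 (local_iterate i t k w).2 ord0 j)%:E
      = (gm i (local_iterate i t k w).1 (local_iterate i t k w).2 ord0 j)%:E)%E.
    by rewrite integral_cst// -[RHS]mule1; congr (_ * _)%E; exact: probability_setT.
  by rewrite subee.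
by have [] := noise_square_integrable.
Qed.

End one_sample.

Lemma known_noise (J : {set source}) i t k :
  (t < T)%N -> (k < K)%N -> rounds_before t \subset J ->
  (forall (t' : 'I_T) (k' : 'I_K), t' = t :> nat -> (k' <= k)%N -> inl (i, t', k') \in J) ->
  vmeasurable (noise i t k : known J -> _).
Proof.
move=> tT kK tJ kJ.
have [mU mV] : vmeasurable ((fun w => (local_iterate i t k w).1) : known J -> _) /\
    vmeasurable ((fun w => (local_iterate i t k w).2) : known J -> _).
  apply: known_local_iterate => //; first exact: ltnW.
  by move=> t' k' tt' /ltnW; exact: kJ.
apply: vmeasurableB; last exact: measurable_gm.
apply: measurable_gs => //.
by apply: (@known_sample J i (Ordinal tT) (Ordinal kK)); exact: kJ.
Qed.

(** One of the two noises always lies in the past of the other: for distinct clients by the choice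
    of [before_sample], for the same client the earlier local step. By symmetry it may be taken to
    be the first. *)
Lemma noises_orthogonal t i k i' k' : (t < T)%N -> (k < K)%N -> (k' < K)%N ->
  (i, k) != (i', k') ->
  mean P (fun w => dot (noise i t k w) (noise i' t k' w)) = 0.
Proof.
move=> tT; wlog kk' : i k i' k' / (i' != i) || (k < k')%N.
  move=> wl kK k'K; case: (boolP ((i' != i) || (k < k')%N)) => [h|]; first exact: wl.
  rewrite negb_or negbK -leqNgt => /andP[/eqP -> k'k] ne.
  under [X in mean P X]eq_fun do rewrite dotC.
  apply: wl => //; last by rewrite eq_sym.
  move: ne; rewrite xpair_eqE eqxx/= => ne.
  by rewrite ltn_neqAle eq_sym ne k'k.
move=> kK k'K _; apply: noise_centered => //; last by have [] := noise_square_integrable i tT kK.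
apply: known_noise => //; first exact: rounds_before_sample.
move=> t' k'' tt' k''k; rewrite inE tt' eqxx ltnn/= eq_sym.
case/orP: kk' => [->//|kk'].
by rewrite (leq_ltn_trans k''k kk') orbT.
Qed.

End oracle.
End run_filtration.

(** * One round in expectation *)

Lemma mean_sqr_double_sum {R : realType} {dO : measure_display}
    {Omega : measurableType dO} (P : probability Omega R) {n d : nat} (K : nat)
    (N : 'I_n -> nat -> Omega -> 'rV[R]_d) (c : R) (A : {set 'I_n}) (k : nat) :
  (forall i j, (j < K)%N -> vL2 P (N i j) /\
                            mean P (fun w => dot (N i j w) (N i j w)) <= c) ->
  (forall i j i' j', (j < K)%N -> (j' < K)%N -> (i, j) != (i', j') ->
    mean P (fun w => dot (N i j w) (N i' j' w)) = 0) ->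
  (k <= K)%N ->
  mean P (fun w => dot (\sum_(i in A) \sum_(j < k) N i j w)
                       (\sum_(i in A) \sum_(j < k) N i j w)) <= #|A|%:R * k%:R * c.
Proof.
move=> N2 N0 kK.
have E w : \sum_(i in A) \sum_(j < k) N i j w =
    \sum_(p in finset.setX A [set: 'I_k]%SET) N p.1 p.2 w.
  by rewrite pair_big; apply: eq_bigl => p /=; rewrite !inE.
under [X in mean P X]eq_fun do rewrite E.
have jK (j : 'I_k) : (j < K)%N by exact: leq_trans kK.
have -> : #|A|%:R * k%:R * c = #|finset.setX A [set: 'I_k]%SET|%:R * c.
  by rewrite cardsX cardsT card_ord natrM.
apply: mean_dot_orthogonal_sum => [p|p|p q pq].
- by have [] := N2 p.1 p.2 (jK p.2).
- by have [] := N2 p.1 p.2 (jK p.2).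
- exact: N0.
Qed.

Lemma ler_sum_ord {R : numDomainType} (x : nat -> R) k K : (k <= K)%N ->
  (forall j, 0 <= x j) -> \sum_(j < k) x j <= \sum_(j < K) x j.
Proof.
move=> kK x0; rewrite -!(big_mkord xpredT) [leRHS](big_cat_nat (leq0n k) kK)//= lerDl.
by apply: sumr_ge0.
Qed.

(** The displacement is split into initial gradient, gradient deviation and noise. The deviations
    are summed over all [K] steps instead of the first [k], so that summing the bound over [k]
    reproduces the total drift on the right. *)
Lemma block_drift_le {R : realType} {d : nat} (c L : R) (k K : nat)
    (g nu : nat -> 'rV[R]_d) (g0 x : 'rV[R]_d) (Dr : nat -> R) : (k <= K)%N ->
  x = - (c *: \sum_(j < k) (g j + nu j)) ->
  (forall j, dot (g j - g0) (g j - g0) <= 2 * L ^+ 2 * Dr j) ->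
  dot x x <= 4 * c ^+ 2 * K%:R ^+ 2 * dot g0 g0
    + 8 * c ^+ 2 * K%:R * L ^+ 2 * (\sum_(j < K) Dr j)
    + 2 * c ^+ 2 * dot (\sum_(j < k) nu j) (\sum_(j < k) nu j).
Proof.
move=> kK -> gD; rewrite dotNl dotNr opprK dotZl dotZr mulrA -expr2 big_split/=.
set G := \sum_(j < k) g j; set N := \sum_(j < k) nu j.
have hG : dot G G <= K%:R * (2 * K%:R * dot g0 g0 + 4 * L ^+ 2 * \sum_(j < K) Dr j).
  apply: (le_trans (dot_sqr_sum_ord_le _)).
  apply: (@le_trans _ _ (K%:R * \sum_(j < K) dot (g j) (g j))).
    apply: ler_pM => //; first by apply: sumr_ge0 => j _; exact: dot_ge0.
      by rewrite ler_nat.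
    by apply: (ler_sum_ord (x := fun j => dot (g j) (g j))) => // j; exact: dot_ge0.
  rewrite ler_wpM2l//.
  have -> : 2 * K%:R * dot g0 g0 + 4 * L ^+ 2 * \sum_(j < K) Dr j =
      \sum_(j < K) (2 * dot g0 g0 + 4 * L ^+ 2 * Dr j).
    by rewrite big_split/= sumr_const card_ord -mulr_sumr -[_ *+ K]mulr_natl; ring.
  apply: ler_sum => j _.
  have := dot_sqrD_le g0 (g j - g0); rewrite addrC subrK.
  have := gD j; lra.
have c2 : 0 <= c ^+ 2 by exact: sqr_ge0.
apply: (le_trans (ler_wpM2l c2 (dot_sqrD_le G N))).
have := ler_wpM2l c2 hG.
rewrite -/G -/N; lra.
Qed.

Section square_integrable_run.
Context {R : realType} {n du dv : nat} {dX dO : measure_display}.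
Context {X : measurableType dX} {Omega : measurableType dO}.
Variables (D : 'I_n -> probability X R) (F : 'rV[R]_du -> 'rV[R]_dv -> X -> R).
Variable P : probability Omega R.
Variables (T K m : nat) (gamma_u gamma_v eta_u eta_v : R).
Variables (u0 : 'rV[R]_du) (v0 : 'I_n -> 'rV[R]_dv).
Variables (xi : 'I_n -> nat -> nat -> {mfun Omega >-> X})
          (S : nat -> Omega -> {set 'I_n}).
Variables (L sigma_u sigma_v : R).
Hypothesis measurable_F : forall u v, measurable_fun setT (F u v).
Hypothesis differentiable_F : forall u v x,
  differentiable (fun u' => F u' v x) u /\ differentiable (fun v' => F u v' x) v.
Hypothesis sampling : fedavgp_sampling D P m T K xi S.
Local Notation f := (client_loss D F).
Hypothesis L0 : 0 < L.
Hypothesis differentiable_f : forall i u v,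
  differentiable ((f i)^~ v) u /\ differentiable (f i u) v.
Hypotheses
  (lip_uu : forall i v, sqr_lipschitz L (fun u => nabla_u (f i) u v))
  (lip_uv : forall i u, sqr_lipschitz L (fun v => nabla_u (f i) u v))
  (lip_vv : forall i u, sqr_lipschitz L (fun v => nabla_v (f i) u v))
  (lip_vu : forall i v, sqr_lipschitz L (fun u => nabla_v (f i) u v)).
Hypothesis oracle : stochastic_gradients D F sigma_u sigma_v.

Local Notation st := (iterate F K m gamma_u gamma_v eta_u eta_v u0 v0 xi S).
Local Notation loc := (local_iterate F K m gamma_u gamma_v eta_u eta_v u0 v0 xi S).
Local Notation noise_u := (noise F K m gamma_u gamma_v eta_u eta_v u0 v0 xi S
  (sample_nabla_u F) (fun i => nabla_u (f i))).
Local Notation noise_v := (noise F K m gamma_u gamma_v eta_u eta_v u0 v0 xi S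
  (sample_nabla_v F) (fun i => nabla_v (f i))).
Local Notation grad_u i t k w := (nabla_u (f i) (loc i t k w).1 (loc i t k w).2).
Local Notation grad_v i t k w := (nabla_v (f i) (loc i t k w).1 (loc i t k w).2).

Let measurable_gs_u := @vmeasurable_sample_nabla_u _ _ _ _ _ F measurable_F differentiable_F.
Let measurable_gs_v := @vmeasurable_sample_nabla_v _ _ _ _ _ F measurable_F differentiable_F.

Let measurable_gm_u i dY (Y : measurableType dY) (U : Y -> 'rV[R]_du) (V : Y -> 'rV[R]_dv) :
  vmeasurable U -> vmeasurable V -> vmeasurable (fun y => nabla_u (f i) (U y) (V y)).
Proof. exact: vmeasurable_nabla_u. Qed.

Let measurable_gm_v i dY (Y : measurableType dY) (U : Y -> 'rV[R]_du) (V : Y -> 'rV[R]_dv) :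
  vmeasurable U -> vmeasurable V -> vmeasurable (fun y => nabla_v (f i) (U y) (V y)).
Proof. exact: vmeasurable_nabla_v. Qed.

Lemma noise_u_square_integrable i t k : (t < T)%N -> (k < K)%N ->
  vL2 P (noise_u i t k) /\
  mean P (fun w => dot (noise_u i t k w) (noise_u i t k w)) <= sigma_u ^+ 2.
Proof.
move=> tT kK; apply: (noise_square_integrable _ _ _ _ _ _ measurable_F differentiable_F
  sampling measurable_gs_u measurable_gm_u) => //.
by move=> j u v; have [] := oracle j u v.
Qed.

Lemma noise_v_square_integrable i t k : (t < T)%N -> (k < K)%N ->
  vL2 P (noise_v i t k) /\
  mean P (fun w => dot (noise_v i t k w) (noise_v i t k w)) <= sigma_v ^+ 2.
Proof.
move=> tT kK; apply: (noise_square_integrable _ _ _ _ _ _ measurable_F differentiable_F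
  sampling measurable_gs_v measurable_gm_v) => //.
by move=> j u v; have [] := oracle j u v.
Qed.

Let subr_scaleD d (c : R) (x y z : 'rV[R]_d) :
  x - c *: (y + z) = x - c *: y - c *: z.
Proof. by rewrite scalerDr opprD addrA. Qed.

Lemma local_iterateS i t k w : loc i t k.+1 w =
  ((loc i t k w).1 - gamma_u *: (grad_u i t k w + noise_u i t k w),
   (loc i t k w).2 - gamma_v *: (grad_v i t k w + noise_v i t k w)).
Proof.
rewrite /local_iterate local_stepsS /noise.
by congr (_ - _ *: _, _ - _ *: _); rewrite addrC subrK.
Qed.

Lemma local_iterate_u i t k w : (loc i t k w).1 = (st t w).1 -
  gamma_u *: \sum_(j < k) (grad_u i t j w + noise_u i t j w).
Proof.
elim: k => [|k IH]; first by rewrite big_ord0 scaler0 subr0.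
by rewrite local_iterateS big_ord_recr [in RHS]subr_scaleD; congr (_ - _); exact: IH.
Qed.

Lemma local_iterate_v i t k w : (loc i t k w).2 = (st t w).2 i -
  gamma_v *: \sum_(j < k) (grad_v i t j w + noise_v i t j w).
Proof.
elim: k => [|k IH]; first by rewrite big_ord0 scaler0 subr0.
by rewrite local_iterateS big_ord_recr [in RHS]subr_scaleD; congr (_ - _); exact: IH.
Qed.

Let vL2_local_of i t k : (t < T)%N -> (k <= K)%N ->
  vL2 P (fun w => (st t w).1) -> vL2 P (fun w => (st t w).2 i) ->
  vL2 P (fun w => (loc i t k w).1) /\ vL2 P (fun w => (loc i t k w).2).
Proof.
move=> tT + u2 v2; elim: k => [|k IH] kK; first by [].
have [uk2 vk2] := IH (ltnW kK).
split; under eq_fun do rewrite local_iterateS.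
  apply: vL2B => //; apply: vL2Z; apply: vL2D.
    exact: vL2_nabla_u.
  by have [] := noise_u_square_integrable i tT kK.
apply: vL2B => //; apply: vL2Z; apply: vL2D.
  exact: vL2_nabla_v.
by have [] := noise_v_square_integrable i tT kK.
Qed.

(** The state that would follow if [A] were drawn. For fixed [A] it depends only on what is known
    before the draw, which separates the draw from the samples. *)
Definition next_iterate t (A : {set 'I_n}) w :=
  fedavgp_round F m K gamma_u gamma_v eta_u eta_v A (fun i k => xi i t k w) (st t w).

Lemma iterateS t w : st t.+1 w = next_iterate t (S t w) w.
Proof. by []. Qed.

Lemma vL2_select d (I : finType) (s : Omega -> I) (g : I -> Omega -> 'rV[R]_d) :
  (forall i, measurable [set w | s w = i]) -> (forall i, vL2 P (g i)) ->
  vL2 P (fun w => g (s w) w).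
Proof.
move=> ms g2.
apply: (@vL2_le _ _ _ _ _ _ (fun w => \sum_i dot (g i w) (g i w))).
- by apply: vmeasurable_select => // i; have [] := g2 i.
- move=> w; rewrite (bigD1 (s w))//= lerDl sumr_ge0// => i _; exact: dot_ge0.
- by apply: rintegrable_sum => i _; have [] := g2 i.
Qed.

Let vL2_next_of t A : (t < T)%N ->
  vL2 P (fun w => (st t w).1) -> (forall i, vL2 P (fun w => (st t w).2 i)) ->
  vL2 P (fun w => (next_iterate t A w).1) /\
  forall i, vL2 P (fun w => (next_iterate t A w).2 i).
Proof.
move=> tT u2 v2; have loc2 i := vL2_local_of tT (leqnn K) u2 (v2 i).
split=> [|i]; under eq_fun do rewrite /next_iterate fedavgp_roundE /=.
  apply: vL2D; first exact: vL2Z.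
  by apply: vL2Z; apply: vL2_sum => i _; have [] := loc2 i.
case: (i \in A); last exact: v2.
by apply: vL2D; apply: vL2Z => //; have [] := loc2 i.
Qed.

Lemma draw_measurable t A : (t < T)%N -> measurable [set w | S t w = A].
Proof. by move=> tT; case: sampling => _ /(_ (Ordinal tT) A)[]. Qed.

(** Gradients grow at most linearly and noises have bounded variance, so square integrability passes
    from step to step; the random draw is harmless because it has finitely many values. *)
Lemma vL2_iterate t : (t <= T)%N ->
  vL2 P (fun w => (st t w).1) /\ forall i, vL2 P (fun w => (st t w).2 i).
Proof.
elim: t => [|t IH] tT; first by split=> [|i]; exact: vL2_cst.
have [u2 v2] := IH (ltnW tT).
have h A := vL2_next_of A tT u2 v2.
split=> [|i]; under eq_fun do rewrite iterateS.
  apply: (@vL2_select _ _ (S t) (fun A w => (next_iterate t A w).1)) => A.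
    exact: draw_measurable.
  by have [] := h A.
apply: (@vL2_select _ _ (S t) (fun A w => (next_iterate t A w).2 i)) => A.
  exact: draw_measurable.
by have [] := h A.
Qed.

Lemma vL2_local_iterate i t k : (t < T)%N -> (k <= K)%N ->
  vL2 P (fun w => (loc i t k w).1) /\ vL2 P (fun w => (loc i t k w).2).
Proof.
by move=> tT kK; have [u2 v2] := vL2_iterate (ltnW tT); exact: vL2_local_of.
Qed.

Lemma vL2_next_iterate t A : (t < T)%N ->
  vL2 P (fun w => (next_iterate t A w).1) /\
  forall i, vL2 P (fun w => (next_iterate t A w).2 i).
Proof. by move=> tT; have [u2 v2] := vL2_iterate (ltnW tT); exact: vL2_next_of. Qed.

Local Notation events := (@run_events n dX X dO Omega T K xi S).
Local Notation known J := (g_sigma_algebraType (cylinders events J)).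

Let events_measurable := @run_events_measurable _ _ _ _ _ _ D P T K m xi S sampling.

(** The source [S t] is outside [before_draw], so the event [S t = A] factors out of the expectation
    and leaves its probability. *)
Lemma mean_indicator_draw t A (g : Omega -> R) : (t < T)%N ->
  measurable_fun [set: known (before_draw T K t)] g -> rintegrable P g ->
  rintegrable P (fun w => \1_[set w | S t w = A] w * g w) /\
  mean P (fun w => \1_[set w | S t w = A] w * g w) = draw_prob m A * mean P g.
Proof.
move=> tT mg gi.
have mE : measurable [set w | S t w = A] by exact: draw_measurable.
have mI : measurable_fun setT (\1_[set w | S t w = A] : Omega -> R).
  exact: measurable_indic.
(* The indicator, a real random variable with its own law, takes the place of the fresh sample in
   [integral_indep]. *)
pose E : {mfun Omega >-> R} := mfun_Sub (mem_set mI).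
have EE w : E w = (S t w == A)%:R.
  by rewrite /= indicE; case: eqP => e; [rewrite mem_set|rewrite memNset].
have EgE : (fun w => \1_[set w | S t w = A] w * g w) = (fun w => E w * g w) by [].
have Ei : rintegrable P (fun w => E w * g w).
  apply: (rintegrable_le (g := fun w => `|g w|)).
  - by apply: measurable_funM => //; exact: rintegrable_measurable gi.
  - by move=> w /=; rewrite normrM indicE; case: (_ \in _); rewrite ?normr0 ?normr1 ?mul1r ?mul0r.
  - exact: integrable_norm.
split; first exact: Ei.
have indep B C : cylinders events (before_draw T K t) B -> measurable C ->
    P (B `&` E @^-1` C) = (P B * distribution P E C)%E.
  move=> GB mC; case: sampling => _ _ ind.
  apply: (cylinders_indep ind (a := inr (Ordinal tT))) GB _.
    by rewrite inE/= ltnn.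
  exists [set A' | C (A' == A)%:R] => //.
  apply/funext => w; change (C (S t w == A)%:R = C (E w)).
  by rewrite EE.
pose phi (z : known (before_draw T K t) * R) : \bar R := (z.2 * g z.1)%:E.
have mphi : measurable_fun setT phi.
  apply/measurable_EFinP; apply: measurable_funM; first exact: measurable_snd.
  exact: (measurableT_comp mg measurable_fst).
have h := integral_indep (@cylinders_measurable _ _ _ _ events_measurable _)
  (@cylindersI _ _ _ _ (@run_eventsI _ _ _ _ _ T K xi S) (before_draw T K t))
  (cylindersT (@run_eventsT _ _ _ _ _ T K xi S) _) indep mphi Ei.
have PE : P [set w | S t w = A] = (draw_prob m A)%:E.
  by case: sampling => _ /(_ (Ordinal tT) A)[].
have intE : (\int[P]_w (E w)%:E = (draw_prob m A)%:E)%E.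
  by rewrite integral_indic// setIT.
have iE : P.-integrable setT (EFin \o E) by exact: integrable_indic.
have iid : (distribution P E).-integrable setT (fun r : R => r%:E).
  by apply: integrable_pushforward => //; exact/measurable_EFinP.
have inner w : (\int[distribution P E]_r phi (w, r) = (draw_prob m A * g w)%:E)%E.
  rewrite /phi/=; under eq_integral do rewrite EFinM.
  by rewrite integralZr// integral_distribution//= intE -EFinM.
rewrite EgE /mean /Rintegral [X in fine X]h.
transitivity (fine (\int[P]_w ((draw_prob m A)%:E * (g w)%:E))%E).
  by congr fine; apply: eq_integral => w _; rewrite -EFinM; exact: inner.
by rewrite integralZl// meanE.
Qed.

Lemma mean_draw t (g : {set 'I_n} -> Omega -> R) : (t < T)%N ->
  (forall A, measurable_fun [set: known (before_draw T K t)] (g A)) ->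
  (forall A, rintegrable P (g A)) ->
  mean P (fun w => g (S t w) w) = draw_mean m (fun A => mean P (g A)).
Proof.
move=> tT mg gi.
have -> : (fun w => g (S t w) w) = (fun w => \sum_A \1_[set w | S t w = A] w * g A w).
  apply/funext => w; rewrite (bigD1 (S t w))//= big1 => [|A Aw].
    by rewrite indicE mem_set// mul1r addr0.
  rewrite indicE memNset ?mul0r//= => Sw.
  by move: Aw; rewrite Sw eqxx.
have h A := mean_indicator_draw A tT (mg A) (gi A).
rewrite mean_sum => [|A _]; last by have [] := h A.
by apply: eq_bigr => A _; have [] := h A.
Qed.

Lemma rintegrable_draw_mean (g : {set 'I_n} -> Omega -> R) :
  (forall A, rintegrable P (g A)) -> rintegrable P (fun w => draw_mean m (g^~ w)).
Proof. by move=> gi; apply: rintegrable_sum => A _; exact: rintegrableZ. Qed.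

Lemma mean_draw_mean (g : {set 'I_n} -> Omega -> R) :
  (forall A, rintegrable P (g A)) ->
  mean P (fun w => draw_mean m (g^~ w)) = draw_mean m (fun A => mean P (g A)).
Proof.
move=> gi; rewrite mean_sum => [|A _]; last exact: rintegrableZ.
by apply: eq_bigr => A _; rewrite meanZ.
Qed.

Variable gamma : R.
Hypotheses (mn : (1 <= m <= n)%N) (K0 : (0 < K)%N).
Hypotheses (gamma0 : 0 < gamma) (gamma_uE : gamma_u * eta_u = gamma)
  (gamma_vE : gamma_v * eta_v = gamma).

Let m0 : m%:R != 0 :> R.
Proof. by rewrite pnatr_eq0 -lt0n; case/andP: mn. Qed.

Let np : 0 < n%:R :> R.
Proof. by rewrite ltr0n; case/andP: mn => /leq_trans; apply. Qed.

Definition sum_grad_u i t w := \sum_(k < K) grad_u i t k w.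
Definition sum_grad_v i t w := \sum_(k < K) grad_v i t k w.
Definition sum_noise_u i t w := \sum_(k < K) noise_u i t k w.
Definition sum_noise_v i t w := \sum_(k < K) noise_v i t k w.
Definition drift i t w := \sum_(k < K)
  (dot ((loc i t k w).1 - (st t w).1) ((loc i t k w).1 - (st t w).1) +
   dot ((loc i t k w).2 - (st t w).2 i) ((loc i t k w).2 - (st t w).2 i)).

(** Local steps followed by relaxation amount to one step of size [gamma' * eta]. Hence a round sees
    only the common product [gamma], while the separate local step sizes matter inside the drift. *)
Let relaxation d (gamma' eta : R) (u x : 'rV[R]_d) :
  (1 - eta) *: u + eta *: (u - gamma' *: x) = u - (gamma' * eta) *: x.
Proof.
by rewrite scalerBl scale1r scalerBr scalerA (mulrC eta) addrA subrK.
Qed.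

Lemma next_iterate_u t (A : {set 'I_n}) w : #|A| = m ->
  (next_iterate t A w).1 = (st t w).1 -
    gamma *: (m%:R^-1 *: \sum_(i in A) (sum_grad_u i t w + sum_noise_u i t w)).
Proof.
move=> Am; rewrite /next_iterate fedavgp_roundE/=.
have -> : \sum_(i in A) (local_steps F gamma_u gamma_v (st t w).1 ((st t w).2 i)
      (xi i t ^~ w) K).1 = \sum_(i in A) ((st t w).1 -
      gamma_u *: (sum_grad_u i t w + sum_noise_u i t w)).
  apply: eq_bigr => i _.
  rewrite -/(local_iterate F K m gamma_u gamma_v eta_u eta_v u0 v0 xi S i t K w).
  by rewrite local_iterate_u big_split.
set G := fun i => sum_grad_u i t w + sum_noise_u i t w.
have -> : (eta_u / m%:R) *: (\sum_(i in A) ((st t w).1 - gamma_u *: G i)) =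
    eta_u *: ((st t w).1 - gamma_u *: (m%:R^-1 *: \sum_(i in A) G i)).
  rewrite sumrB sumr_const Am -scaler_sumr -[(st t w).1 *+ m]scaler_nat !scalerBr !scalerA.
  by congr (_ *: _ - _ *: _); field.
by rewrite relaxation gamma_uE.
Qed.

(** Clients outside [A] are given the increment 0, so the same descent inequality applies to every
    client. *)
Lemma next_iterate_v t A i w : (next_iterate t A w).2 i = (st t w).2 i +
  (if i \in A then - (gamma *: (sum_grad_v i t w + sum_noise_v i t w)) else 0).
Proof.
rewrite /next_iterate fedavgp_roundE/=; case: (i \in A); last by rewrite addr0.
rewrite -/(local_iterate F K m gamma_u gamma_v eta_u eta_v u0 v0 xi S i t K w).
by rewrite local_iterate_v relaxation gamma_vE big_split.
Qed.

Lemma nabla_u_global u (v : 'I_n -> 'rV[R]_dv) :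
  nabla_u (global_loss D F) u v = n%:R^-1 *: \sum_i nabla_u (f i) u (v i).
Proof.
have df i : differentiable ((f i)^~ (v i)) u by have [] := differentiable_f i u (v i).
have E : (global_loss D F)^~ v = n%:R^-1 \*: (\sum_(i < n) ((f i)^~ (v i))).
  by apply/funext => x; rewrite /global_loss/= fct_sumE.
apply/rowP => j; rewrite !mxE summxE E.
rewrite deriveZ; last by apply: derivable_sum => i; exact: diff_derivable.
rewrite derive_sum => [|i]; last exact: diff_derivable.
by congr (_ * _); apply: eq_bigr => i _; rewrite mxE.
Qed.

Local Notation gbar t w := (n%:R^-1 *: \sum_i nabla_u (f i) (st t w).1 ((st t w).2 i)).
Local Notation G_u i t w := (nabla_u (f i) (st t w).1 ((st t w).2 i)).
Local Notation G_v i t w := (nabla_v (f i) (st t w).1 ((st t w).2 i)).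

Let f_descent i := two_block_descent L0 (differentiable_f i) (lip_uu i) (lip_uv i) (lip_vv i).

Lemma next_iterate_descent t w (A : {set 'I_n}) M : #|A| = m ->
  M = m%:R^-1 *: \sum_(i in A) (sum_grad_u i t w + sum_noise_u i t w) ->
  global_loss D F (next_iterate t A w).1 (next_iterate t A w).2 <=
    global_loss D F (st t w).1 (st t w).2 - gamma * dot (gbar t w) M
  - gamma / n%:R * (\sum_(i in A) dot (G_v i t w) (sum_grad_v i t w + sum_noise_v i t w))
  + L * gamma ^+ 2 * dot M M
  + L * gamma ^+ 2 / n%:R * (\sum_(i in A) dot (sum_grad_v i t w + sum_noise_v i t w)
                                              (sum_grad_v i t w + sum_noise_v i t w)).
Proof.
move=> Am ME.
have h : n%:R^-1 * \sum_i f i (next_iterate t A w).1 ((next_iterate t A w).2 i) <=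
  n%:R^-1 * \sum_i (f i (st t w).1 ((st t w).2 i) + dot (G_u i t w) (- (gamma *: M))
    + (if i \in A then - gamma * dot (G_v i t w) (sum_grad_v i t w + sum_noise_v i t w) else 0)
    + L * dot (gamma *: M) (gamma *: M)
    + (if i \in A then L * gamma ^+ 2 * dot (sum_grad_v i t w + sum_noise_v i t w)
                                              (sum_grad_v i t w + sum_noise_v i t w) else 0)).
  rewrite ler_pM2l ?invr_gt0//; apply: ler_sum => i _.
  rewrite next_iterate_u// next_iterate_v -ME.
  apply: (le_trans (f_descent i _ _ _ _)).
  rewrite le_eqVlt; apply/orP; left; apply/eqP; case: (i \in A).
    rewrite !(dotNl, dotNr, dotZl, dotZr); ring.
  rewrite !dot0r !(dotNl, dotNr, dotZl, dotZr); ring.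
rewrite /global_loss; apply: (le_trans h).
rewrite !big_split/= -dot_suml -!big_mkcond/= sumr_const card_ord -!mulr_sumr.
rewrite !(dotNr, dotZr, dotZl) -[_ *+ n]mulr_natl.
rewrite le_eqVlt; apply/orP; left; apply/eqP; field.
by rewrite gt_eqF.
Qed.

Let known_st (J : {set 'I_n * 'I_T * 'I_K + 'I_T}) t := @known_iterate _ _ _ _ _ _ _ _
  F T K m gamma_u gamma_v eta_u eta_v u0 v0 xi S measurable_F differentiable_F J t.

Let known_loc (J : {set 'I_n * 'I_T * 'I_K + 'I_T}) := @known_local_iterate _ _ _ _ _ _ _ _
  F T K m gamma_u gamma_v eta_u eta_v u0 v0 xi S measurable_F differentiable_F J.

Lemma known_next_iterate t A : (t < T)%N ->
  vmeasurable ((fun w => (next_iterate t A w).1) : known (before_draw T K t) -> _) /\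
  forall i, vmeasurable ((fun w => (next_iterate t A w).2 i) : known (before_draw T K t) -> _).
Proof.
move=> tT.
have [mU mV] := known_st (ltnW tT) (rounds_before_draw T K t).
have mloc i : vmeasurable ((fun w => (loc i t K w).1) : known (before_draw T K t) -> _) /\
    vmeasurable ((fun w => (loc i t K w).2) : known (before_draw T K t) -> _).
  apply: known_loc => //; first exact: rounds_before_draw.
  by move=> t' k' tt' _; rewrite inE tt'.
split=> [|i].
  under eq_fun do rewrite /next_iterate fedavgp_roundE /=.
  apply: vmeasurableD; first exact: vmeasurableZ.
  by apply: vmeasurableZ; apply: vmeasurable_sum => i; have [] := mloc i.
under eq_fun do rewrite /next_iterate fedavgp_roundE /=.
case: (i \in A); last exact: mV.
by apply: vmeasurableD; apply: vmeasurableZ => //; have [] := mloc i.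
Qed.

Lemma rintegrable_global (U : Omega -> 'rV[R]_du) (V : 'I_n -> Omega -> 'rV[R]_dv) :
  vL2 P U -> (forall i, vL2 P (V i)) ->
  rintegrable P (fun w => global_loss D F (U w) (V^~ w)).
Proof.
move=> U2 V2; apply: rintegrableZ; apply: rintegrable_sum => i _.
exact: (rintegrable_two_block L0 (differentiable_f i) (lip_uu i) (lip_uv i) (lip_vv i) (lip_vu i)).
Qed.

(** After this exchange the draw is a finite average inside the expectation, and the descent can be
    averaged over it outcome by outcome. *)
Lemma mean_global_next t : (t < T)%N ->
  mean P (fun w => global_loss D F (st t.+1 w).1 (st t.+1 w).2) =
  mean P (fun w => draw_mean m (fun A =>
    global_loss D F (next_iterate t A w).1 (next_iterate t A w).2)).
Proof.
move=> tT.
have gi A : rintegrable P (fun w =>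
    global_loss D F (next_iterate t A w).1 (next_iterate t A w).2).
  by have [u2 v2] := vL2_next_iterate A tT; exact: rintegrable_global.
rewrite (mean_draw_mean gi) -(mean_draw tT _ gi)// => A.
have [mU mV] := known_next_iterate A tT.
apply: measurable_funM; first exact: measurable_cst.
apply: measurable_fun_rsum => i.
exact: (measurable_two_block (differentiable_f i)).
Qed.

Let vL2_G_u i t : (t < T)%N -> vL2 P (fun w => G_u i t w).
Proof.
move=> tT; have [u2 v2] := vL2_iterate (ltnW tT).
exact: (vL2_nabla_u (differentiable_f i) (lip_uu i) (lip_uv i)).
Qed.

Let vL2_G_v i t : (t < T)%N -> vL2 P (fun w => G_v i t w).
Proof.
move=> tT; have [u2 v2] := vL2_iterate (ltnW tT).
exact: (vL2_nabla_v (differentiable_f i) (lip_vv i) (lip_vu i)).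
Qed.

Let vL2_gbar t : (t < T)%N -> vL2 P (fun w => gbar t w).
Proof. by move=> tT; apply: vL2Z; apply: vL2_sum => i _; exact: vL2_G_u. Qed.

Let unbiased_u i u v : has_mean (D i) (sample_nabla_u F u v) (nabla_u (f i) u v).
Proof. by have [] := oracle i u v. Qed.

Let unbiased_v i u v : has_mean (D i) (sample_nabla_v F u v) (nabla_v (f i) u v).
Proof. by have [] := oracle i u v. Qed.

Let variance_u i u v : ('E_(D i)[fun x => (enorm (sample_nabla_u F u v x -
  nabla_u (f i) u v) ^+ 2)%R] <= (sigma_u ^+ 2)%:E)%E.
Proof. by have [] := oracle i u v. Qed.

Let variance_v i u v : ('E_(D i)[fun x => (enorm (sample_nabla_v F u v x -
  nabla_v (f i) u v) ^+ 2)%R] <= (sigma_v ^+ 2)%:E)%E.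
Proof. by have [] := oracle i u v. Qed.

Let noise_u_centered := @noise_centered _ _ _ _ _ _ _ _ D F P T K m gamma_u gamma_v
  eta_u eta_v u0 v0 xi S measurable_F differentiable_F sampling _ _ _ _
  measurable_gs_u measurable_gm_u unbiased_u variance_u.

Let noise_v_centered := @noise_centered _ _ _ _ _ _ _ _ D F P T K m gamma_u gamma_v
  eta_u eta_v u0 v0 xi S measurable_F differentiable_F sampling _ _ _ _
  measurable_gs_v measurable_gm_v unbiased_v variance_v.

Let noise_u_orthogonal := @noises_orthogonal _ _ _ _ _ _ _ _ D F P T K m gamma_u gamma_v
  eta_u eta_v u0 v0 xi S measurable_F differentiable_F sampling _ _ _ _
  measurable_gs_u measurable_gm_u unbiased_u variance_u.

Let noise_v_orthogonal := @noises_orthogonal _ _ _ _ _ _ _ _ D F P T K m gamma_u gamma_v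
  eta_u eta_v u0 v0 xi S measurable_F differentiable_F sampling _ _ _ _
  measurable_gs_v measurable_gm_v unbiased_v variance_v.

Lemma mean_noise_u_sums t (A : {set 'I_n}) k : (t < T)%N -> (k <= K)%N ->
  mean P (fun w => dot (\sum_(i in A) \sum_(j < k) noise_u i t j w)
                       (\sum_(i in A) \sum_(j < k) noise_u i t j w))
    <= #|A|%:R * k%:R * sigma_u ^+ 2.
Proof.
move=> tT kK.
apply: (mean_sqr_double_sum (K := K) (N := fun i j => noise_u i t j)) => //.
  by move=> i j jK; exact: noise_u_square_integrable.
by move=> i j i' j' jK j'K; exact: noise_u_orthogonal.
Qed.

Lemma mean_noise_v_sums t (A : {set 'I_n}) k : (t < T)%N -> (k <= K)%N ->
  mean P (fun w => dot (\sum_(i in A) \sum_(j < k) noise_v i t j w)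
                       (\sum_(i in A) \sum_(j < k) noise_v i t j w))
    <= #|A|%:R * k%:R * sigma_v ^+ 2.
Proof.
move=> tT kK.
apply: (mean_sqr_double_sum (K := K) (N := fun i j => noise_v i t j)) => //.
  by move=> i j jK; exact: noise_v_square_integrable.
by move=> i j i' j' jK j'K; exact: noise_v_orthogonal.
Qed.

Let vL2_noise_u_sum i t k : (t < T)%N -> (k <= K)%N ->
  vL2 P (fun w => \sum_(j < k) noise_u i t j w).
Proof.
move=> tT kK; apply: vL2_sum => j _.
by have [] := noise_u_square_integrable i tT (leq_trans (ltn_ord j) kK).
Qed.

Let vL2_noise_v_sum i t k : (t < T)%N -> (k <= K)%N ->
  vL2 P (fun w => \sum_(j < k) noise_v i t j w).
Proof.
move=> tT kK; apply: vL2_sum => j _.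
by have [] := noise_v_square_integrable i tT (leq_trans (ltn_ord j) kK).
Qed.

Lemma mean_gbar_noise t : (t < T)%N ->
  mean P (fun w => dot (gbar t w) (n%:R^-1 *: \sum_i sum_noise_u i t w)) = 0.
Proof.
move=> tT; have gb2 := vL2_gbar tT.
under [X in mean P X]eq_fun do rewrite dotZr dot_sumr.
have gN i : rintegrable P (fun w => dot (gbar t w) (sum_noise_u i t w)).
  by apply: rintegrable_dot => //; exact: vL2_noise_u_sum.
rewrite meanZ; last by apply: rintegrable_sum.
rewrite mean_sum// big1 ?mulr0// => i _.
under [X in mean P X]eq_fun do rewrite dot_sumr.
have N2 (k : 'I_K) := (noise_u_square_integrable i tT (ltn_ord k)).1.
rewrite mean_sum => [|k _]; last exact: rintegrable_dot.
apply: big1 => k _; apply: noise_u_centered => //.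
have [mU mV] := known_st (ltnW tT) (rounds_before_sample T K i t k).
by apply: vmeasurableZ; apply: vmeasurable_sum => i'; exact: measurable_gm_u.
Qed.

Lemma mean_grad_v_noise i t : (t < T)%N ->
  mean P (fun w => dot (G_v i t w) (sum_noise_v i t w)) = 0.
Proof.
move=> tT; have g2 := vL2_G_v i tT.
under [X in mean P X]eq_fun do rewrite dot_sumr.
have N2 (k : 'I_K) := (noise_v_square_integrable i tT (ltn_ord k)).1.
rewrite mean_sum => [|k _]; last exact: rintegrable_dot.
apply: big1 => k _; apply: noise_v_centered => //.
have [mU mV] := known_st (ltnW tT) (rounds_before_sample T K i t k).
exact: measurable_gm_v.
Qed.

Lemma drift_ge0 i t w : 0 <= drift i t w.
Proof. by apply: sumr_ge0 => k _; rewrite addr_ge0// dot_ge0. Qed.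

Lemma sum_grad_u_deviation i t w :
  dot (sum_grad_u i t w - K%:R *: G_u i t w) (sum_grad_u i t w - K%:R *: G_u i t w)
    <= 2 * L ^+ 2 * K%:R * drift i t w.
Proof.
have -> : sum_grad_u i t w - K%:R *: G_u i t w = \sum_(k < K) (grad_u i t k w - G_u i t w).
  by rewrite sumrB sumr_const card_ord scaler_nat.
apply: (le_trans (dot_sqr_sum_ord_le _)).
rewrite [leRHS]mulrAC mulrC ler_wpM2r// mulr_sumr; apply: ler_sum => k _.
exact: (nabla_u_lipschitz (lip_uu i) (lip_uv i)).
Qed.

Lemma sum_grad_v_deviation i t w :
  dot (sum_grad_v i t w - K%:R *: G_v i t w) (sum_grad_v i t w - K%:R *: G_v i t w)
    <= 2 * L ^+ 2 * K%:R * drift i t w.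
Proof.
have -> : sum_grad_v i t w - K%:R *: G_v i t w = \sum_(k < K) (grad_v i t k w - G_v i t w).
  by rewrite sumrB sumr_const card_ord scaler_nat.
apply: (le_trans (dot_sqr_sum_ord_le _)).
rewrite [leRHS]mulrAC mulrC ler_wpM2r// mulr_sumr; apply: ler_sum => k _.
exact: (nabla_v_lipschitz (lip_vv i) (lip_vu i)).
Qed.

Let rintegrable_drift i t : (t < T)%N -> rintegrable P (drift i t).
Proof.
move=> tT; have [u2 v2] := vL2_iterate (ltnW tT).
apply: rintegrable_sum => k _.
have [uk2 vk2] := vL2_local_iterate i tT (ltnW (ltn_ord k)).
by apply: rintegrableD; apply: rintegrable_dot; apply: vL2B.
Qed.

Hypotheses (gamma_u0 : 0 < gamma_u) (gamma_v0 : 0 < gamma_v).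
Hypotheses (gamma_u_le : gamma_u <= gamma) (gamma_v_le : gamma_v <= gamma).
Hypothesis step : gamma * L * K%:R <= 32^-1.

(** Summing the displacement bounds over the local steps bounds the drift by the wanted terms plus
    [1 / 64] of itself; the factor [64 / 63] comes from absorbing that share. *)
Lemma mean_drift i t : (t < T)%N -> mean P (drift i t) <=
  64 / 63 * (4 * K%:R ^+ 3 * (gamma_u ^+ 2 * mean P (fun w => dot (G_u i t w) (G_u i t w))
                            + gamma_v ^+ 2 * mean P (fun w => dot (G_v i t w) (G_v i t w)))
    + 2 * K%:R ^+ 2 * (gamma_u ^+ 2 * sigma_u ^+ 2 + gamma_v ^+ 2 * sigma_v ^+ 2)).
Proof.
move=> tT.
have [u2 v2] := vL2_iterate (ltnW tT).
have Gu1 : rintegrable P (fun w => dot (G_u i t w) (G_u i t w)) := (vL2_G_u i tT).2.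
have Gv1 : rintegrable P (fun w => dot (G_v i t w) (G_v i t w)) := (vL2_G_v i tT).2.
set gU := mean P (fun w => dot (G_u i t w) (G_u i t w)).
set gV := mean P (fun w => dot (G_v i t w) (G_v i t w)).
set SD := mean P (drift i t).
have SD0 : 0 <= SD by apply: mean_ge0 => w; exact: drift_ge0.
have hk (k : 'I_K) : mean P (fun w =>
  dot ((loc i t k w).1 - (st t w).1) ((loc i t k w).1 - (st t w).1) +
  dot ((loc i t k w).2 - (st t w).2 i) ((loc i t k w).2 - (st t w).2 i)) <=
  4 * K%:R ^+ 2 * (gamma_u ^+ 2 * gU + gamma_v ^+ 2 * gV)
  + 8 * K%:R * L ^+ 2 * (gamma_u ^+ 2 + gamma_v ^+ 2) * SD
  + 2 * K%:R * (gamma_u ^+ 2 * sigma_u ^+ 2 + gamma_v ^+ 2 * sigma_v ^+ 2).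
  have kK := ltnW (ltn_ord k).
  have [uk2 vk2] := vL2_local_iterate i tT kK.
  pose Nu w := \sum_(j < k) noise_u i t j w; pose Nv w := \sum_(j < k) noise_v i t j w.
  have Nu1 : rintegrable P (fun w => dot (Nu w) (Nu w)) := (vL2_noise_u_sum i tT kK).2.
  have Nv1 : rintegrable P (fun w => dot (Nv w) (Nv w)) := (vL2_noise_v_sum i tT kK).2.
  have NuE : mean P (fun w => dot (Nu w) (Nu w)) <= K%:R * sigma_u ^+ 2.
    have := mean_noise_u_sums [set i]%SET tT kK.
    under [X in mean P X]eq_fun do rewrite !big_set1.
    rewrite cards1 mul1r => /le_trans; apply.
    by rewrite ler_wpM2r ?sqr_ge0// ler_nat.
  have NvE : mean P (fun w => dot (Nv w) (Nv w)) <= K%:R * sigma_v ^+ 2.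
    have := mean_noise_v_sums [set i]%SET tT kK.
    under [X in mean P X]eq_fun do rewrite !big_set1.
    rewrite cards1 mul1r => /le_trans; apply.
    by rewrite ler_wpM2r ?sqr_ge0// ler_nat.
  pose Dr w j := dot ((loc i t j w).1 - (st t w).1) ((loc i t j w).1 - (st t w).1) +
    dot ((loc i t j w).2 - (st t w).2 i) ((loc i t j w).2 - (st t w).2 i).
  have hu w : dot ((loc i t k w).1 - (st t w).1) ((loc i t k w).1 - (st t w).1) <=
      4 * gamma_u ^+ 2 * K%:R ^+ 2 * dot (G_u i t w) (G_u i t w)
      + 8 * gamma_u ^+ 2 * K%:R * L ^+ 2 * drift i t w
      + 2 * gamma_u ^+ 2 * dot (Nu w) (Nu w).
    apply: (@block_drift_le R du gamma_u L k K (fun j => grad_u i t j w)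
      (fun j => noise_u i t j w) _ _ (Dr w) kK).
      by rewrite local_iterate_u addrAC subrr add0r.
    by move=> j; exact: (nabla_u_lipschitz (lip_uu i) (lip_uv i)).
  have hv w : dot ((loc i t k w).2 - (st t w).2 i) ((loc i t k w).2 - (st t w).2 i) <=
      4 * gamma_v ^+ 2 * K%:R ^+ 2 * dot (G_v i t w) (G_v i t w)
      + 8 * gamma_v ^+ 2 * K%:R * L ^+ 2 * drift i t w
      + 2 * gamma_v ^+ 2 * dot (Nv w) (Nv w).
    apply: (@block_drift_le R dv gamma_v L k K (fun j => grad_v i t j w)
      (fun j => noise_v i t j w) _ _ (Dr w) kK).
      by rewrite local_iterate_v addrAC subrr add0r.
    by move=> j; exact: (nabla_v_lipschitz (lip_vv i) (lip_vu i)).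
  have iD := rintegrable_drift i tT.
  apply: (le_trans (mean_le _ _ (fun w => lerD (hu w) (hv w)))).
  - by apply: rintegrableD; apply: rintegrable_dot; apply: vL2B.
  - by do ?[apply: rintegrableD | apply: rintegrableZ].
  rewrite !meanD ?meanZ//; try by do ?[apply: rintegrableD | apply: rintegrableZ].
  rewrite -/SD -/gU -/gV.
  have cu : 0 <= 2 * gamma_u ^+ 2 by rewrite mulr_ge0// sqr_ge0.
  have cv : 0 <= 2 * gamma_v ^+ 2 by rewrite mulr_ge0// sqr_ge0.
  have := ler_wpM2l cu NuE; have := ler_wpM2l cv NvE; lra.
have SDE : SD <= K%:R * (4 * K%:R ^+ 2 * (gamma_u ^+ 2 * gU + gamma_v ^+ 2 * gV)
  + 8 * K%:R * L ^+ 2 * (gamma_u ^+ 2 + gamma_v ^+ 2) * SD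
  + 2 * K%:R * (gamma_u ^+ 2 * sigma_u ^+ 2 + gamma_v ^+ 2 * sigma_v ^+ 2)).
  rewrite {1}/SD mean_sum => [|k _]; last first.
    have [uk2 vk2] := vL2_local_iterate i tT (ltnW (ltn_ord k)).
    by apply: rintegrableD; apply: rintegrable_dot; apply: vL2B.
  apply: (le_trans (ler_sum _ (fun k _ => hk k))).
  by rewrite sumr_const card_ord [leRHS]mulr_natl.
(* The drift bounds itself with a factor [1 / 64], so no induction on the local
   steps is needed. *)
have contraction : K%:R * (8 * K%:R * L ^+ 2 * (gamma_u ^+ 2 + gamma_v ^+ 2) * SD) <=
    64^-1 * SD.
  rewrite mulrA ler_wpM2r//.
  have hu : gamma_u ^+ 2 <= gamma ^+ 2 by rewrite lerXn2r ?nnegrE// ltW.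
  have hv : gamma_v ^+ 2 <= gamma ^+ 2 by rewrite lerXn2r ?nnegrE// ltW.
  (* Each local step size is at most [gamma], so [8 + 8 = 16] times [(gamma L K)^2 <= 1 / 32^2]
     gives [1 / 64]. *)
  apply: (@le_trans _ _ (16 * (gamma * L * K%:R) ^+ 2)).
    have KL0 : 0 <= 8 * (K%:R * L) ^+ 2 by rewrite mulr_ge0// sqr_ge0.
    have := ler_wpM2l KL0 (lerD hu hv); lra.
  have h0 : 0 <= gamma * L * K%:R by rewrite !mulr_ge0// ltW.
  have : (gamma * L * K%:R) ^+ 2 <= 32^-1 ^+ 2 by rewrite lerXn2r ?nnegrE.
  lra.
move: SDE contraction; lra.
Qed.

Variable b : R.
Hypothesis dissimilarity : bounded_dissimilarity D F b.

(** The inequality averaged over the draw holds for every outcome and is integrated: the linear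
    noise terms vanish, and orthogonality bounds the squared noise sums by [K] times the variances,
    divided by [m] for the mean over the draw. *)
Lemma round_descent t : (t < T)%N ->
  mean P (fun w => global_loss D F (st t.+1 w).1 (st t.+1 w).2) <=
  mean P (fun w => global_loss D F (st t w).1 (st t w).2)
  - (gamma * K%:R / 2 - 4 * L * gamma ^+ 2 * K%:R ^+ 2) *
      (mean P (fun w => dot (gbar t w) (gbar t w)) +
       m%:R / n%:R ^+ 2 * \sum_i mean P (fun w => dot (G_v i t w) (G_v i t w)))
  + 8 * L * gamma ^+ 2 * K%:R ^+ 2 * ((n%:R - m%:R) / (m%:R * n%:R) * b ^+ 2)
  + 5 / 2 * gamma * L ^+ 2 * (n%:R^-1 * \sum_i mean P (drift i t))
  + 2 * L * gamma ^+ 2 * K%:R * (sigma_u ^+ 2 / m%:R + m%:R / n%:R * sigma_v ^+ 2).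
Proof.
move=> tT; have [u2 v2] := vL2_iterate (ltnW tT).
pose sq_u w := dot (gbar t w) (gbar t w).
pose sq_v w := \sum_i dot (G_v i t w) (G_v i t w).
pose fl w := global_loss D F (st t w).1 (st t w).2.
pose DD w := \sum_i drift i t w.
pose p w := dot (gbar t w) (n%:R^-1 *: \sum_i sum_noise_u i t w).
pose q w := \sum_i dot (G_v i t w) (sum_noise_v i t w).
pose MN (A : {set 'I_n}) w := dot (m%:R^-1 *: \sum_(i in A) sum_noise_u i t w)
                   (m%:R^-1 *: \sum_(i in A) sum_noise_u i t w).
pose Z w := \sum_i dot (sum_noise_v i t w) (sum_noise_v i t w).
have Xi : rintegrable P sq_u := (vL2_gbar tT).2.
have Yi : rintegrable P sq_v by apply: rintegrable_sum => i _; exact: (vL2_G_v i tT).2.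
have fli : rintegrable P fl by exact: rintegrable_global.
have DDi : rintegrable P DD by apply: rintegrable_sum => i _; exact: rintegrable_drift.
have Nu2 i := vL2_noise_u_sum i tT (leqnn K).
have Nv2 i := vL2_noise_v_sum i tT (leqnn K).
have pI : rintegrable P p.
  by apply: rintegrable_dot; [exact: vL2_gbar|apply: vL2Z; apply: vL2_sum => i _; exact: Nu2].
have qI : rintegrable P q.
  by apply: rintegrable_sum => i _; apply: rintegrable_dot; [exact: vL2_G_v|exact: Nv2].
have MNi A : rintegrable P (MN A).
  by have [] : vL2 P (fun w => m%:R^-1 *: \sum_(i in A) sum_noise_u i t w)
    by apply: vL2Z; apply: vL2_sum => i _; exact: Nu2.
have Zi : rintegrable P Z by apply: rintegrable_sum => i _; exact: (Nv2 i).2.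
have MDi := rintegrable_draw_mean MNi.
have hw w : draw_mean m (fun A => global_loss D F (next_iterate t A w).1 (next_iterate t A w).2)
  <= fl w
  - (gamma * K%:R / 2 - 4 * L * gamma ^+ 2 * K%:R ^+ 2) * (sq_u w + m%:R / n%:R ^+ 2 * sq_v w)
  + 8 * L * gamma ^+ 2 * K%:R ^+ 2 * ((n%:R - m%:R) / (m%:R * n%:R) * b ^+ 2)
  + 5 / 2 * gamma * L ^+ 2 * (n%:R^-1 * DD w)
  - gamma * p w - gamma * (m%:R / n%:R ^+ 2) * q w
  + 2 * L * gamma ^+ 2 * (draw_mean m (MN^~ w) + m%:R / n%:R ^+ 2 * Z w).
  apply: (averaged_descent mn K0 gamma0 L0 step) => //.
  - have := dissimilarity (st t w).1 (st t w).2.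
    by rewrite enorm_sqr nabla_u_global; under eq_bigr do rewrite enorm_sqr.
  - by move=> i; exact: drift_ge0.
  - by move=> i; exact: sum_grad_u_deviation.
  - by move=> i; exact: sum_grad_v_deviation.
  - by move=> A Am; exact: next_iterate_descent.
rewrite mean_global_next//; apply: (le_trans (mean_le _ _ hw)).
- apply: rintegrable_draw_mean => A.
  by have [? ?] := vL2_next_iterate A tT; exact: rintegrable_global.
- by do ?[assumption | apply: rintegrableB | apply: rintegrableD |
          apply: rintegrableZ | exact: rintegrable_cst].
have flE : mean P (fun w => global_loss D F (st t w).1 (st t w).2) = mean P fl by [].
(* The loss, itself a scaled sum, is made an atom for the linearity rules. *)
rewrite flE; clearbody fl.
rewrite !(meanB, meanD, meanZ, mean_cst); try by do ?[assumption | apply: rintegrableB |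
  apply: rintegrableD | apply: rintegrableZ | exact: rintegrable_cst].
have p0 : mean P p = 0 by exact: mean_gbar_noise.
have q0 : mean P q = 0.
  rewrite mean_sum => [|i _]; first by apply: big1 => i _; exact: mean_grad_v_noise.
  by apply: rintegrable_dot; [exact: vL2_G_v|exact: Nv2].
have YE : mean P sq_v = \sum_i mean P (fun w => dot (G_v i t w) (G_v i t w)).
  by rewrite mean_sum// => i _; exact: (vL2_G_v i tT).2.
have DDE : mean P DD = \sum_i mean P (drift i t).
  by rewrite mean_sum// => i _; exact: rintegrable_drift.
have ZE : mean P Z <= n%:R * (K%:R * sigma_v ^+ 2).
  rewrite mean_sum => [|i _]; last exact: (Nv2 i).2.
  rewrite mulr_natl -[n in leRHS]card_ord -sumr_const; apply: ler_sum => i _.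
  have := mean_noise_v_sums [set i]%SET tT (leqnn K).
  under [X in mean P X]eq_fun do rewrite !big_set1.
  by rewrite cards1 mul1r.
have mp : 0 < m%:R :> R by rewrite lt_neqAle eq_sym m0 ler0n.
have ME : mean P (fun w => draw_mean m (MN^~ w)) <= K%:R * sigma_u ^+ 2 / m%:R.
  rewrite mean_draw_mean// -[leRHS](draw_mean_cst mn); apply: draw_mean_le => A Am.
  rewrite /MN; under [X in mean P X]eq_fun do rewrite dotZl dotZr mulrA.
  rewrite meanZ; last first.
    by have [] : vL2 P (fun w => \sum_(i in A) sum_noise_u i t w)
      by apply: vL2_sum => i _; exact: Nu2.
  have := mean_noise_u_sums A tT (leqnn K); rewrite Am => h.
  apply: (le_trans (ler_wpM2l _ h)); first by rewrite mulr_ge0// invr_ge0.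
  by rewrite le_eqVlt; apply/orP; left; apply/eqP; field.
rewrite p0 q0 YE DDE.
have c0 : 0 <= 2 * L * gamma ^+ 2 by rewrite !mulr_ge0 ?sqr_ge0// ltW.
have c1 : 0 <= m%:R / n%:R ^+ 2 :> R by rewrite divr_ge0// exprn_ge0.
have := ler_wpM2l c0 (lerD ME (ler_wpM2l c1 ZE)).
rewrite -/sq_u.
have -> : 2 * L * gamma ^+ 2 * (K%:R * sigma_u ^+ 2 / m%:R + m%:R / n%:R ^+ 2 *
    (n%:R * (K%:R * sigma_v ^+ 2))) =
  2 * L * gamma ^+ 2 * K%:R * (sigma_u ^+ 2 / m%:R + m%:R / n%:R * sigma_v ^+ 2).
  by field; rewrite m0 gt_eqF.
lra.
Qed.

End square_integrable_run.

(** * The rate *)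

(** Budget with [x = gamma L k <= 1 / 32]. From the factor [1 / 2] of [gamma k G] the squared step
    takes [4 x <= 1 / 8] and the drift less than [1 / 64], so [1 / 4] is left; the same drift share
    covers the term in [E]. The drift adds about [5 x] to the factor 2 of [N], which stays below 3,
    and [8 q] is below [3 * 4 q]. *)
Lemma round_progress {R : realFieldType}
    (gamma L k a a' G q N E drift B M : R) :
  0 < gamma -> 0 < L -> 0 < k -> gamma * L * k <= 32^-1 ->
  0 <= G -> 0 <= q -> 0 <= N -> 0 <= E ->
  a' <= a - (gamma * k / 2 - 4 * L * gamma ^+ 2 * k ^+ 2) * G
    + 8 * L * gamma ^+ 2 * k ^+ 2 * q + 5 / 2 * gamma * L ^+ 2 * drift
    + 2 * L * gamma ^+ 2 * k * N ->
  drift <= 64 / 63 * (4 * k ^+ 3 * B + 2 * k ^+ 2 * M) ->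
  B <= gamma ^+ 2 * (E + G) -> M <= gamma ^+ 2 * N ->
  a' <= a - gamma * k / 4 * G + 3 * L * gamma ^+ 2 * k * (4 * k * q + N)
    + gamma * k / 4 * E.
Proof.
move=> g0 L0 k0 x32 G0 q0 N0 E0 ha hdrift hB hM.
have x0 : 0 <= gamma * L * k by rewrite !mulr_ge0// ltW.
have gk0 : 0 <= gamma * k by rewrite mulr_ge0// ltW.
have EG0 : 0 <= gamma * k * (E + G) by rewrite mulr_ge0// addr_ge0.
have LN0 : 0 <= L * gamma ^+ 2 * k * N by rewrite !mulr_ge0// ?sqr_ge0// ltW.
have Lq0 : 0 <= L * gamma ^+ 2 * k * (k * q) by rewrite !mulr_ge0// ?sqr_ge0// ltW.
have gG0 : 0 <= gamma * k * G by rewrite mulr_ge0.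
have gE0 : 0 <= gamma * k * E by rewrite mulr_ge0.
have x2 : (gamma * L * k) ^+ 2 <= 32^-1 ^+ 2 by rewrite lerXn2r ?nnegrE.
have h1 := ler_wpM2r EG0 x2.
have h2 := ler_wpM2r LN0 x32.
have h3 := ler_wpM2r gG0 x32.
have c0 : 0 <= 5 / 2 * gamma * L ^+ 2.
  by rewrite mulr_ge0 ?sqr_ge0// mulr_ge0// ltW.
have k3 : 0 <= 64 / 63 * (4 * k ^+ 3).
  by rewrite mulr_ge0 ?divr_ge0// mulr_ge0// exprn_ge0// ltW.
have k2 : 0 <= 64 / 63 * (2 * k ^+ 2).
  by rewrite mulr_ge0 ?divr_ge0// mulr_ge0// exprn_ge0// ltW.
have h4 : drift <= 64 / 63 * (4 * k ^+ 3) * (gamma ^+ 2 * (E + G)) +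
    64 / 63 * (2 * k ^+ 2) * (gamma ^+ 2 * N).
  have := ler_wpM2l k3 hB; have := ler_wpM2l k2 hM; lra.
have h5 := ler_wpM2l c0 h4.
lra.
Qed.

(** After division by [gamma k T / 4] the term [F0] becomes [4 F0 / (k T)] times [32 L k + s], where
    [s] is the square root in [gamma]: this is [128 L F0 / T] plus half of the leading term. The
    variance term gives the other half, and the remainder [L F0 / T] makes 129. *)
Lemma averaged_rate {R : rcfType} (gamma L k T F0 A : R) (S : R) :
  0 < L -> 0 < k -> 0 < T -> 0 < F0 -> 0 <= A ->
  gamma = (32 * L * k + Num.sqrt (3 * L * k * T / F0 * A))^-1 ->
  gamma * k / 4 * S <= F0 + T * (3 * L * gamma ^+ 2 * k * A + gamma * k / 4 * (L * F0 / T)) ->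
  T^-1 * S <= 8 * Num.sqrt (3 * A * (L * F0 / (k * T))) + 129 * L * F0 / T.
Proof.
move=> L0 k0 T0 F00 A0 gE h.
set s := Num.sqrt _ in gE.
have s0 : 0 <= s by exact: sqrtr_ge0.
have s2 : s ^+ 2 = 3 * L * k * T / F0 * A.
  by rewrite sqr_sqrtr// !mulr_ge0 ?invr_ge0// ltW.
have -> : Num.sqrt (3 * A * (L * F0 / (k * T))) = F0 / (k * T) * s.
  apply/eqP; rewrite -(@eqrXn2 _ 2)// ?sqrtr_ge0//; last first.
    by rewrite !mulr_ge0 ?invr_ge0 ?mulr_ge0// ltW.
  rewrite exprMn s2 sqr_sqrtr; last by rewrite !mulr_ge0 ?invr_ge0 ?mulr_ge0// ltW.
  by apply/eqP; field; rewrite !gt_eqF.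
have d0 : 0 < 32 * L * k + s by rewrite ltr_wpDr// !mulr_gt0.
have g0 : 0 < gamma by rewrite gE invr_gt0.
have gd : gamma * (32 * L * k + s) = 1 by rewrite gE mulVf// gt_eqF.
have gs1 : gamma * s <= 1.
  by rewrite -gd ler_pM2l// lerDr !mulr_ge0// ltW.
have AE : 3 * L * A = F0 / (k * T) * s ^+ 2.
  by rewrite s2; field; rewrite !gt_eqF.
have gk0 : 0 < gamma * k / 4 by rewrite divr_gt0// mulr_gt0.
rewrite ler_pdivrMl// -(ler_pM2l gk0); apply: (le_trans h).
(* The variance term is [F0 (gamma s)^2]; [gamma s <= 1] lowers the power to one, matching the other
   half of the leading term. *)
have gsF : 0 <= gamma * s * F0 * (1 - gamma * s).
  by rewrite mulr_ge0 ?subr_ge0// !mulr_ge0// ltW.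
have -> : 3 * L * gamma ^+ 2 * k * A = gamma ^+ 2 * k * (F0 / (k * T) * s ^+ 2).
  by rewrite -AE; ring.
rewrite -subr_ge0 [X in 0 <= X](_ : _ = gamma * s * F0 * (1 - gamma * s)
    + F0 * (gamma * (32 * L * k + s) - 1)); last by field; rewrite !gt_eqF.
by rewrite gd subrr mulr0 addr0.
Qed.

Theorem corollary3p8 (R : realType) (n du dv : nat)
    (dX : measure_display) (X : measurableType dX)
    (D : 'I_n -> probability X R)
    (F : 'rV[R]_du -> 'rV[R]_dv -> X -> R)
    (dOmega : measure_display) (Omega : measurableType dOmega) (P : probability Omega R)
    (T K m : nat) (gamma_u gamma_v eta_u eta_v gamma : R)
    (u0 : 'rV[R]_du) (v0 : 'I_n -> 'rV[R]_dv)
    (xi : 'I_n -> nat -> nat -> {mfun Omega >-> X})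
    (S : nat -> Omega -> {set 'I_n})
    (Lu Lv Luv Lvu L sigma_u sigma_v b F0 : R) :
  (1 <= T)%N -> (1 <= K)%N -> (1 <= m <= n)%N ->
  0 < gamma_u -> 0 < gamma_v -> 0 < eta_u -> 0 < eta_v ->
  gamma_u * eta_u = gamma -> gamma_v * eta_v = gamma ->
  well_posed D F ->
  smooth_losses D F Lu Lv Luv Lvu ->
  L = Num.max (Num.max Lu Lv) (Num.max Luv Lvu) -> 0 < L ->
  stochastic_gradients D F sigma_u sigma_v ->
  0 < b -> bounded_dissimilarity D F b ->
  initial_gap D F u0 v0 = F0%:E -> 0 < F0 ->
  fedavgp_sampling D P m T K xi S ->
  let A := 4 * (n%:R - m%:R) * K%:R * b ^+ 2 / (m%:R * n%:R)
           + sigma_u ^+ 2 / m%:R + m%:R * sigma_v ^+ 2 / n%:R in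
  gamma = (32 * L * K%:R + Num.sqrt (3 * L * K%:R * T%:R / F0 * A))^-1 ->
  Num.sqrt (n%:R / m%:R) <= eta_v ->
  Num.max (Num.sqrt m%:R) (Num.sqrt (b ^+ 2 * T%:R / (L * F0))) <= eta_u ->
  let st t w := fedavgp F m K gamma_u gamma_v eta_u eta_v u0 v0
                  (S^~ w) (fun i t k => xi i t k w) t in
  (((T%:R)^-1)%:E * \sum_(t < T) (Gu D F P (st t) + Gv_hat D F P m (st t))
   <= (8 * Num.sqrt (3 * A * (L * F0 / (K%:R * T%:R)))
       + 129 * L * F0 / T%:R)%:E)%E.
Proof.
move=> T1 K1 mn gu0 gv0 eu0 ev0 guE gvE wp smooth LE L0 oracle b0 dissim gap
  F00 sampling A gE hev heu; cbv zeta.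
have n0 : (0 < n)%N by case/andP: mn => /leq_trans; apply.
have m1 : (0 < m)%N by case/andP: mn.
(* Measurability is contained in integrability under the law of any client, and [0 < n] supplies a
   client. *)
have mF u v : measurable_fun setT (F u v).
  by have [/(_ (Ordinal n0) u v)/integrableP[/measurable_EFinP]] := wp.
have dF := wp.2.
have dfl i u v : differentiable ((client_loss D F i)^~ v) u /\
    differentiable (client_loss D F i u) v by have [] := smooth i.
have [LuL LvL LuvL LvuL] : [/\ Lu <= L, Lv <= L, Luv <= L & Lvu <= L].
  by rewrite LE !le_max !lexx ?orbT.
have luu i v : sqr_lipschitz L (fun u => nabla_u (client_loss D F i) u v).
  by have [_ h _ _ _] := smooth i; exact: elipschitz_sqr LuL (h v).
have luv i u : sqr_lipschitz L (fun v => nabla_u (client_loss D F i) u v).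
  by have [_ _ h _ _] := smooth i; exact: elipschitz_sqr LuvL (h u).
have lvv i u : sqr_lipschitz L (fun v => nabla_v (client_loss D F i) u v).
  by have [_ _ _ h _] := smooth i; exact: elipschitz_sqr LvL (h u).
have lvu i v : sqr_lipschitz L (fun u => nabla_v (client_loss D F i) u v).
  by have [_ _ _ _ h] := smooth i; exact: elipschitz_sqr LvuL (h v).
have Kp : 0 < K%:R :> R by rewrite ltr0n.
have Tp : 0 < T%:R :> R by rewrite ltr0n.
have mp : 0 < m%:R :> R by rewrite ltr0n.
have np : 0 < n%:R :> R by rewrite ltr0n.
have mn' : m%:R <= n%:R :> R by rewrite ler_nat; case/andP: mn.
have m1' : 1 <= m%:R :> R by rewrite (ler_nat R 1 m).
have g0 : 0 < gamma by rewrite -guE mulr_gt0.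
pose E := L * F0 / T%:R.
have E0 : 0 <= E by rewrite divr_ge0 ?mulr_ge0// ltW.
have [eu_m eu_b] : m%:R <= eta_u ^+ 2 /\ b ^+ 2 / E <= eta_u ^+ 2.
  move: heu; rewrite ge_max => /andP[h1 h2]; split.
    by rewrite -(@sqr_sqrtr _ m%:R)// lerXn2r ?nnegrE ?sqrtr_ge0// ltW.
  have -> : b ^+ 2 / E = b ^+ 2 * T%:R / (L * F0) by rewrite /E; field; rewrite !gt_eqF.
  rewrite -[leLHS]sqr_sqrtr; last by rewrite divr_ge0 ?mulr_ge0 ?sqr_ge0// ltW.
  by rewrite lerXn2r ?nnegrE ?sqrtr_ge0// ltW.
have ev_n : n%:R / m%:R <= eta_v ^+ 2.
  rewrite -[leLHS]sqr_sqrtr ?divr_ge0//.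
  by rewrite lerXn2r ?nnegrE ?sqrtr_ge0// ltW.
have gu2 : gamma_u ^+ 2 * eta_u ^+ 2 = gamma ^+ 2 by rewrite -guE exprMn.
have gv2 : gamma_v ^+ 2 * eta_v ^+ 2 = gamma ^+ 2 by rewrite -gvE exprMn.
(* With [gamma] fixed, lower bounds on the server steps are upper bounds on the local steps. [gu_m]
   gives the shared noise its factor [1 / m], [gu_b] turns [b^2] into [E], and [gv_n] supplies the
   factor [m / n] carried by the personal gradients. *)
have gu_m : gamma_u ^+ 2 * m%:R <= gamma ^+ 2 by rewrite -gu2 ler_wpM2l ?sqr_ge0.
have gu_b : gamma_u ^+ 2 * b ^+ 2 <= gamma ^+ 2 * E.
  have Ep : 0 < E by rewrite divr_gt0// mulr_gt0.
  by rewrite -ler_pdivrMr// -mulrA -gu2 ler_wpM2l ?sqr_ge0.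
have gv_n : gamma_v ^+ 2 <= gamma ^+ 2 * (m%:R / n%:R).
  rewrite -gv2 -mulrA -[leLHS]mulr1 ler_wpM2l ?sqr_ge0//.
  by move: ev_n; rewrite ler_pdivrMr// => h; rewrite mulrA ler_pdivlMr// mul1r.
have gu_g : gamma_u ^+ 2 <= gamma ^+ 2.
  by apply: le_trans gu_m; rewrite -[leLHS]mulr1 ler_wpM2l ?sqr_ge0.
have gv_g : gamma_v ^+ 2 <= gamma ^+ 2.
  apply: (le_trans gv_n); rewrite -[leRHS]mulr1 ler_wpM2l ?sqr_ge0//.
  by rewrite ler_pdivrMr// mul1r.
have gu_le : gamma_u <= gamma by rewrite -(@ler_pXn2r _ 2) ?nnegrE// ltW.
have gv_le : gamma_v <= gamma by rewrite -(@ler_pXn2r _ 2) ?nnegrE// ltW.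
have step : gamma * L * K%:R <= 32^-1.
  rewrite -mulrA gE mulrC ler_pdivrMr; last first.
    by rewrite ltr_wpDr ?sqrtr_ge0// !mulr_gt0.
  set r := Num.sqrt _; have r0 : 0 <= r by exact: sqrtr_ge0.
  lra.
pose iter := iterate F K m gamma_u gamma_v eta_u eta_v u0 v0 xi S.
pose a t := mean P (fun w => global_loss D F (iter t w).1 (iter t w).2).
pose gu i t w := nabla_u (client_loss D F i) (iter t w).1 ((iter t w).2 i).
pose gv i t w := nabla_v (client_loss D F i) (iter t w).1 ((iter t w).2 i).
pose gbar t w := n%:R^-1 *: \sum_i gu i t w.
pose sq_u i t := mean P (fun w => dot (gu i t w) (gu i t w)).
pose sq_v i t := mean P (fun w => dot (gv i t w) (gv i t w)).
pose sq_bar t := mean P (fun w => dot (gbar t w) (gbar t w)).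
pose G t := sq_bar t + m%:R / n%:R ^+ 2 * \sum_i sq_v i t.
have L2 t : (t <= T)%N -> vL2 P (fun w => (iter t w).1) /\
    forall i, vL2 P (fun w => (iter t w).2 i).
  exact: (vL2_iterate _ _ _ _ _ _ mF dF sampling dfl luu luv lvv lvu oracle).
have gu2i i t : (t <= T)%N -> vL2 P (gu i t).
  by move=> /L2[u2 v2]; exact: (vL2_nabla_u (dfl i) (luu i) (luv i)).
have gv2i i t : (t <= T)%N -> vL2 P (gv i t).
  by move=> /L2[u2 v2]; exact: (vL2_nabla_v (dfl i) (lvv i) (lvu i)).
have gbar2 t : (t <= T)%N -> vL2 P (gbar t).
  by move=> tT; apply: vL2Z; apply: vL2_sum => i _; exact: gu2i.
(* The drift involves the shared gradients of the individual clients; this exchanges them for the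
   global gradient plus [b^2], which [gu_b] then absorbs. *)
have dissim_mean t : (t <= T)%N -> n%:R^-1 * \sum_i sq_u i t <= b ^+ 2 + sq_bar t.
  move=> tT; rewrite -mean_sum => [|i _]; last exact: (gu2i i t tT).2.
  rewrite -meanZ; last by apply: rintegrable_sum => i _; exact: (gu2i i t tT).2.
  rewrite -(mean_cst P (b ^+ 2)) -meanD; last 2 first.
  - exact: rintegrable_cst.
  - exact: (gbar2 t tT).2.
  apply: mean_le.
  - by apply: rintegrableZ; apply: rintegrable_sum => i _; exact: (gu2i i t tT).2.
  - by apply: rintegrableD; [exact: rintegrable_cst|exact: (gbar2 t tT).2].
  move=> w; have := dissim (iter t w).1 (iter t w).2.
  by rewrite enorm_sqr (nabla_u_global dfl); under eq_bigr do rewrite enorm_sqr.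
have sq_bar0 t : 0 <= sq_bar t by apply: mean_ge0 => w; exact: dot_ge0.
have sq_v0 i t : 0 <= sq_v i t by apply: mean_ge0 => w; exact: dot_ge0.
have rho0 : 0 <= m%:R / n%:R ^+ 2 :> R by rewrite divr_ge0// exprn_ge0// ltW.
have sum_v0 t : 0 <= m%:R / n%:R ^+ 2 * \sum_i sq_v i t.
  by rewrite mulr_ge0// sumr_ge0.
have G0 t : 0 <= G t by rewrite addr_ge0.
pose q : R := (n%:R - m%:R) / (m%:R * n%:R) * b ^+ 2.
pose N : R := sigma_u ^+ 2 / m%:R + m%:R / n%:R * sigma_v ^+ 2.
have q0 : 0 <= q.
  by apply: mulr_ge0; [apply: divr_ge0; rewrite ?subr_ge0// mulr_ge0|exact: sqr_ge0].
have N0 : 0 <= N.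
  apply: addr_ge0; first by rewrite divr_ge0 ?sqr_ge0.
  by apply: mulr_ge0; [rewrite divr_ge0|exact: sqr_ge0].
have AE : A = 4 * K%:R * q + N by rewrite /A /q /N; field; rewrite !gt_eqF.
have progress t : (t < T)%N -> a t.+1 <= a t - gamma * K%:R / 4 * G t
    + 3 * L * gamma ^+ 2 * K%:R * A + gamma * K%:R / 4 * E.
  move=> tT; rewrite AE.
  have hround := round_descent u0 v0 mF dF sampling L0 dfl luu luv lvv lvu oracle
    mn K1 g0 guE gvE step dissim tT.
  apply: (round_progress g0 L0 Kp step (G0 t) q0 N0 E0 hround
    (B := gamma_u ^+ 2 * (n%:R^-1 * \sum_i sq_u i t) +
          gamma_v ^+ 2 * (n%:R^-1 * \sum_i sq_v i t))
    (M := gamma_u ^+ 2 * sigma_u ^+ 2 + gamma_v ^+ 2 * sigma_v ^+ 2)).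
  - have hi i := mean_drift eta_u eta_v u0 v0 mF dF sampling L0 dfl luu luv lvv lvu
      oracle g0 gu0 gv0 gu_le gv_le step i tT.
    rewrite ler_pdivrMl//; apply: (le_trans (ler_sum _ (fun i _ => hi i))).
    rewrite -mulr_sumr big_split/= -mulr_sumr big_split/= -!mulr_sumr sumr_const card_ord.
    rewrite -[_ *+ n]mulr_natl le_eqVlt; apply/orP; left; apply/eqP; rewrite /sq_u /sq_v.
    by field; rewrite gt_eqF.
  - have h1 : gamma_u ^+ 2 * (n%:R^-1 * \sum_i sq_u i t) <= gamma ^+ 2 * E + gamma ^+ 2 * sq_bar t.
      apply: (le_trans (ler_wpM2l (sqr_ge0 _) (dissim_mean t (ltnW tT)))).
      by rewrite mulrDr lerD// ler_wpM2r.
    have h2 : gamma_v ^+ 2 * (n%:R^-1 * \sum_i sq_v i t) <=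
        gamma ^+ 2 * (m%:R / n%:R ^+ 2 * \sum_i sq_v i t).
      have -> : gamma ^+ 2 * (m%:R / n%:R ^+ 2 * \sum_i sq_v i t) =
        gamma ^+ 2 * (m%:R / n%:R) * (n%:R^-1 * \sum_i sq_v i t) by field; rewrite gt_eqF.
      by apply: ler_wpM2r => //; rewrite mulr_ge0 ?sumr_ge0// invr_ge0 ltW.
    by rewrite /G mulrDr mulrDr; lra.
  - have h1 : gamma_u ^+ 2 * sigma_u ^+ 2 <= gamma ^+ 2 * (sigma_u ^+ 2 / m%:R).
      by rewrite mulrA ler_pdivlMr// mulrAC ler_wpM2r ?sqr_ge0.
    have h2 : gamma_v ^+ 2 * sigma_v ^+ 2 <= gamma ^+ 2 * (m%:R / n%:R * sigma_v ^+ 2).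
      by rewrite [leRHS]mulrA ler_wpM2r ?sqr_ge0.
    by rewrite /N mulrDr lerD.
have telescope t : (t <= T)%N -> gamma * K%:R / 4 * \sum_(j < t) G j <=
    a 0%N - a t + t%:R * (3 * L * gamma ^+ 2 * K%:R * A + gamma * K%:R / 4 * E).
  elim: t => [|t IH] tT; first by rewrite big_ord0 subrr mul0r mulr0 addr0.
  have := IH (ltnW tT); have := progress t tT.
  by rewrite big_ord_recr/= -[t.+1%:R]natr1; lra.
(* A finite initial gap excludes both infinite values of the infimum, so the infimum is a real lower
   bound of the loss. *)
have lower u v : global_loss D F u0 v0 - F0 <= global_loss D F u v.
  have : (ereal_inf (range (fun p : 'rV[R]_du * ('I_n -> 'rV[R]_dv) =>
      (global_loss D F p.1 p.2)%:E)) <= (global_loss D F u v)%:E)%E.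
    by apply: ereal_inf_lbound; exists (u, v).
  move: gap; rewrite /initial_gap; case: (ereal_inf _) => [r| |]//=.
  by move=> [<-]; rewrite lee_fin; lra.
have a0E : a 0%N = global_loss D F u0 v0 by rewrite -[RHS](mean_cst P).
have aT : global_loss D F u0 v0 - F0 <= a T.
  rewrite -(mean_cst P (_ - _)); have [u2 v2] := L2 T (leqnn T).
  apply: mean_le => //; first exact: rintegrable_cst.
  exact: (rintegrable_global L0 dfl luu luv lvv lvu).
have A0 : 0 <= A by rewrite AE addr_ge0// mulr_ge0// mulr_ge0// ltW.
have rate := averaged_rate (S := \sum_(t < T) G t) L0 Kp Tp F00 A0 gE.
(* Square integrability of the gradients identifies the extended-real expectations of the statement
   with the real means used so far. *)
have -> : (\sum_(t < T) (Gu D F P (iter t) + Gv_hat D F P m (iter t)) =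
    (\sum_(t < T) G t)%R%:E)%E.
  rewrite -sumEFin; apply: eq_bigr => t _; have tT := ltnW (ltn_ord t).
  rewrite EFinD; congr (_ + _)%E.
    rewrite /Gu unlock /sq_bar -meanE; last exact: (gbar2 t tT).2.
    by apply: eq_integral => w _; rewrite enorm_sqr (nabla_u_global dfl).
  rewrite /Gv_hat [RHS]EFinM -sumEFin; congr (_ * _)%E; apply: eq_bigr => i _.
  rewrite unlock /sq_v -meanE; last exact: (gv2i i t tT).2.
  by apply: eq_integral => w _; rewrite enorm_sqr.
rewrite -EFinM lee_fin; apply: rate.
have := telescope T (leqnn T); rewrite a0E /E; lra.
Qed.
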